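(* The following $\{o;c\}$-sequence $\square$ with the following operations is a cofibrant replacement of $\mathcal{A}ct_{>0}$ in the model category of $\mathcal{A}ct_{>0}$-bimodules. Put $\square(n;c)=[0,1]^{n-1}$ and $\square(n;o)=[0,1]^{n-1}$ for $n>0$, and $\square$ empty otherwise. The structure is: \begin{itemize} \item $-\circ^{i}\ast_{2;c}:\square(n;c)\to\square(n+1;c)$, $(t_{1},\ldots,t_{n-1})\mapsto(t_{1},\ldots,t_{i-1},0,t_{i},\ldots,t_{n-1})$, $1\leq i\leq n$; \item $-\circ^{i}\ast_{2;c}:\square(n;o)\to\square(n+1;o)$, $(t_{1},\ldots,t_{n-1})\mapsto(t_{1},\ldots,t_{i-1},0,t_{i},\ldots,t_{n-1})$, $1\leq i\leq n-1$; \item $-\circ^{n}\ast_{2;o}:\square(n;o)\to\square(n+1;o)$, $(t_{1},\ldots,t_{n-1})\mapsto(t_{1},\ldots,t_{n-1},0)$; \item $\ast_{2;c}(-,-):\square(n;c)\times\square(m;c)\to\square(n+m;c)$, $\big((t_{1},\ldots,t_{n-1}),(t'_{1},\ldots,t'_{m-1})\big)\mapsto(t_{1},\ldots,t_{n-1},1,t'_{1},\ldots,t'_{m-1})$; \item $\ast_{2;o}(-,-):\square(n;c)\times\square(m;o)\to\square(n+m;o)$, $\big((t_{1},\ldots,t_{n-1}),(t'_{1},\ldots,t'_{m-1})\big)\mapsto(t_{1},\ldots,t_{n-1},1,t'_{1},\ldots,t'_{m-1})$. \end{itemize}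
   Context: ''Space'' means compactly generated Hausdorff space. For a set $S$, an $S$-sequence is a family of spaces $O(s_1,\dots,s_n;s_{n+1})$, $n\ge 0$, $s_i\in S$. A (non-symmetric) $S$-operad is an $S$-sequence with partial compositions $\circ_i$ and units satisfying the usual axioms. For an $\{o;c\}$-sequence $M$ write $M(n;c)=M(c,\dots,c;c)$ ($n$ inputs $c$) and $M(n;o)=M(c,\dots,c,o;o)$ ($n-1$ inputs $c$ followed by one input $o$). $\mathcal{A}ct_{>0}$ is the $\{o;c\}$-operad with $\mathcal{A}ct_{>0}(n;c)=\{\ast_{n;c}\}$ and $\mathcal{A}ct_{>0}(n;o)=\{\ast_{n;o}\}$ for $n>0$ and empty otherwise, with the unique compositions. It is generated as a coloured operad by $\ast_{2;c}$ and $\ast_{2;o}$, so the action of these elements determines a bimodule structure. A bimodule over an $S$-operad $O$ is an $S$-sequence $M$ with left operations $O(s_1,\dots,s_n;s_{n+1})\times M(s^1_1,\dots,s^1_{p_1};s_1)\times\cdots\times M(s^n_1,\dots,s^n_{p_n};s_n)\to M(s^1_1,\dots,s^n_{p_n};s_{n+1})$, written $x(y_1,\dots,y_n)$, and right operations $\circ^i:M(s_1,\dots,s_n;s_{n+1})\times O(s'_1,\dots,s'_m;s_i)\to M(s_1,\dots,s_{i-1},s'_1,\dots,s'_m,s_{i+1},\dots,s_n;s_{n+1})$ satisfying the usual associativity and unit axioms. $\mathcal{A}ct_{>0}$ is a bimodule over itself. The model structure on $O$-bimodules has componentwise weak homotopy equivalences and Serre fibrations as weak equivalences and fibrations. A cofibrant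 replacement of an object is a cofibrant object with a weak equivalence to it. *)

(* Defs.v *)
From HB Require Import structures.
From mathcomp Require Import all_boot all_order all_algebra.
From mathcomp Require Import all_classical all_reals all_analysis.

Set Implicit Arguments.
Unset Strict Implicit.
Unset Printing Implicit Defensive.

Import Order.TTheory GRing.Theory Num.Theory numFieldNormedType.Exports.
Local Open Scope classical_set_scope.

(** * Compactly generated Hausdorff spaces *)

(* [open (A : set (subspace K))] means that [A `&` K] is relatively open in [K]. *)
Definition k_open (T : topologicalType) (A : set T) : Prop :=
  forall K : set T, compact K -> open (A : set (subspace K)).

Record space := Space {
  space_top :> topologicalType;
  space_hausdorff : hausdorff_space space_top;
  space_compactly_generated : forall A : set space_top, k_open A -> open A }.

Definition kification (T : topologicalType) : Type := T.

Section Kification.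
Variable T : topologicalType.

Lemma k_openT : k_open [set: T].
Proof. by move=> K _; exact: openT. Qed.

Lemma k_openI : setI_closed (@k_open T).
Proof. by move=> A B kA kB K cK; apply: openI; [exact: kA | exact: kB]. Qed.

Lemma k_open_bigcup (I : Type) (f : I -> set T) :
  (forall i, k_open (f i)) -> k_open (\bigcup_i f i).
Proof. by move=> kf K cK; apply: bigcup_open => i _; exact: kf. Qed.

HB.instance Definition _ := Choice.on (kification T).
HB.instance Definition _ :=
  isOpenTopological.Build (kification T) k_openT k_openI k_open_bigcup.

End Kification.

(* The categorical product of compactly generated Hausdorff spaces is the
   k-ification of their product topology, so this is continuity of a map whose
   domain [X], a finite topological product, is given the product structure of
   the category of spaces. *)
Definition kcontinuous (X Y : topologicalType) (f : X -> Y) : Prop :=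
  continuous (f : kification X -> Y).

Lemma compact_compactly_generated (T : topologicalType) (A : set T) :
  compact [set: T] -> k_open A -> open A.
Proof.
move=> cT /(_ _ cT) /open_subspaceP [V oV].
by rewrite !setIT => <-.
Qed.

(** * Sequences, operads and bimodules *)

(* [M w s] is the space $M(w_1,\dots,w_n;s)$ for [w = [:: w_1; ...; w_n]]. *)
Notation colseq S := (seq S -> S -> space).

Definition cast (S : Type) (M : colseq S) (s : S) (w w' : seq S)
    (e : w = w') (x : M w s) : M w' s :=
  eq_rect w (fun v => M v s : Type) x w' e.

Section WordEquations.
Variable S : Type.
Implicit Types (l r u m p q : seq S) (L P : seq (seq S)).

Lemma splice_nest l l' u r' r :
  l ++ (l' ++ u ++ r') ++ r = (l ++ l') ++ u ++ (r' ++ r).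
Proof. by rewrite -!catA. Qed.

Lemma splice_right l u m r : l ++ u ++ (m ++ r) = (l ++ u ++ m) ++ r.
Proof. by rewrite -!catA. Qed.

Lemma flatten_nest P1 P2 P3 :
  flatten (P1 ++ P2 ++ P3) = flatten (P1 ++ flatten P2 :: P3) :> seq S.
Proof. by rewrite !flatten_cat. Qed.

Lemma flatten_splice P1 p u q P2 :
  flatten (P1 ++ (p ++ u ++ q) :: P2)
  = (flatten P1 ++ p) ++ u ++ (q ++ flatten P2).
Proof. by rewrite flatten_cat /= -!catA. Qed.

End WordEquations.

Section RightOperations.
Variables (S : Type) (M O : colseq S).

(* [act x y], with [x] in [M (l ++ a :: r) s], is $x \circ^{i} y$ for
   $i = |l| + 1$. *)
Definition right_op :=
  forall (l : seq S) (a : S) (r u : seq S) (s : S),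
    M (l ++ a :: r) s -> O u a -> M (l ++ u ++ r) s.

Definition right_op_continuous (act : right_op) : Prop :=
  forall l a r u s,
    kcontinuous (fun z : M (l ++ a :: r) s * O u a => act l a r u s z.1 z.2).

(* $(x \circ y) \circ z = x \circ (y \circ z)$ when [z] is grafted into an
   input of [y]. *)
Definition sequential_assoc (act : right_op)
    (comp : forall l a r u s, O (l ++ a :: r) s -> O u a -> O (l ++ u ++ r) s)
    : Prop :=
  forall (l r l' r' u : seq S) (a b s : S)
    (x : M (l ++ a :: r) s) (y : O (l' ++ b :: r') a) (z : O u b),
  act (l ++ l') b (r' ++ r) u s
    (cast (splice_nest l l' [:: b] r' r) (act l a r (l' ++ b :: r') s x y)) z
  = cast (splice_nest l l' u r' r)
      (act l a r (l' ++ u ++ r') s x (comp l' b r' u a y z)).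

(* $(x \circ y) \circ z = (x \circ z) \circ y$ when [y] and [z] are grafted
   into two distinct inputs of [x]. *)
Definition parallel_assoc (act : right_op) : Prop :=
  forall (l m r u v : seq S) (a b s : S)
    (x : M (l ++ a :: (m ++ b :: r)) s) (y : O u a) (z : O v b),
  act (l ++ u ++ m) b r v s
    (cast (splice_right l u m (b :: r)) (act l a (m ++ b :: r) u s x y)) z
  = cast (splice_right l u m (v ++ r))
      (act l a (m ++ v ++ r) u s
        (cast (esym (splice_right l [:: a] m (v ++ r)))
          (act (l ++ a :: m) b r v s
            (cast (splice_right l [:: a] m (b :: r)) x) z))
        y).

Definition right_unital (act : right_op) (unit : forall s, O [:: s] s) : Prop :=
  forall l a r s (x : M (l ++ a :: r) s), act l a r [:: a] s x (unit a) = x.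

End RightOperations.

Record operad (S : Type) := Operad {
  op_seq :> colseq S;
  op_unit : forall s, op_seq [:: s] s;
  op_comp : right_op op_seq op_seq;
  op_comp_continuous : right_op_continuous op_comp;
  op_sequential : sequential_assoc op_comp op_comp;
  op_parallel : parallel_assoc op_comp;
  op_right_unital : right_unital op_comp op_unit;
  op_left_unital : forall u s (x : op_seq u s),
    cast (cats0 u) (@op_comp [::] s [::] u s (op_unit s) x) = x }.

Definition discrete_space (T : choiceType) : topologicalType :=
  discrete_topology T.

(* $M(p_1;w_1) \times \cdots \times M(p_n;w_n)$ for [P = [:: p_1; ...; p_n]] and
   [w = [:: w_1; ...; w_n]]; empty if [P] and [w] have different sizes. *)
Fixpoint hprod (S : Type) (M : colseq S) (P : seq (seq S)) (w : seq S)
    : topologicalType :=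
  match P, w with
  | [::], [::] => discrete_space unit
  | p :: P', a :: w' => (M p a * hprod M P' w')%type
  | _, _ => discrete_space void
  end.

Fixpoint hcat (S : Type) (M : colseq S) (P : seq (seq S)) (w : seq S)
    (P2 : seq (seq S)) (w2 : seq S) :
    hprod M P w -> hprod M P2 w2 -> hprod M (P ++ P2) (w ++ w2) :=
  match P, w return
    hprod M P w -> hprod M P2 w2 -> hprod M (P ++ P2) (w ++ w2) with
  | [::], [::] => fun _ y => y
  | p :: P', a :: w' => fun x y => (x.1, hcat x.2 y)
  | [::], _ :: _ => fun x _ => match (x : void) with end
  | _ :: _, [::] => fun x _ => match (x : void) with end
  end.

Fixpoint hmap (S : Type) (M N : colseq S) (f : forall w s, M w s -> N w s)
    (P : seq (seq S)) (w : seq S) : hprod M P w -> hprod N P w :=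
  match P, w return hprod M P w -> hprod N P w with
  | [::], [::] => fun x => x
  | p :: P', a :: w' => fun x => (f p a x.1, hmap f x.2)
  | [::], _ :: _ => fun x => x
  | _ :: _, [::] => fun x => x
  end.

Record bimod_struct (S : Type) (O : operad S) (M : colseq S) := BimodStruct {
  ract : right_op M O;
  lact : forall (w : seq S) (s : S) (P : seq (seq S)),
    O w s -> hprod M P w -> M (flatten P) s;
  ract_continuous : right_op_continuous ract;
  lact_continuous : forall w s P,
    kcontinuous (fun z : O w s * hprod M P w => lact z.1 z.2);
  ract_sequential : sequential_assoc ract (@op_comp S O);
  ract_parallel : parallel_assoc ract;
  ract_unital : right_unital ract (@op_unit S O);
  lact_unital : forall p s (y : M p s),
    cast (cats0 p)
      (lact (P := [:: p]) (op_unit O s) (y, tt)) = y;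
  (* $(x \circ x')(y_1, y_2, y_3) = x(y_1, x'(y_2), y_3)$ *)
  lact_assoc : forall l a r u s (P1 P2 P3 : seq (seq S))
    (x : O (l ++ a :: r) s) (x' : O u a)
    (y1 : hprod M P1 l) (y2 : hprod M P2 u) (y3 : hprod M P3 r),
    cast (flatten_nest P1 P2 P3)
      (lact (op_comp x x') (hcat y1 (hcat y2 y3)))
    = lact x (hcat (w2 := a :: r) (P2 := flatten P2 :: P3)
               y1 (lact x' y2, y3));
  (* $x(y_1, y, y_2) \circ z = x(y_1, y \circ z, y_2)$ *)
  lact_ract : forall l a r s (P1 P2 : seq (seq S)) (p q v : seq S) (b : S)
    (x : O (l ++ a :: r) s) (y1 : hprod M P1 l) (y : M (p ++ b :: q) a)
    (y2 : hprod M P2 r) (z : O v b),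
    ract (l := flatten P1 ++ p) (r := q ++ flatten P2)
      (cast (flatten_splice P1 p [:: b] q P2)
        (lact x (hcat (w2 := a :: r) (P2 := (p ++ b :: q) :: P2)
                  y1 (y, y2)))) z
    = cast (flatten_splice P1 p v q P2)
        (lact x (hcat (w2 := a :: r) (P2 := (p ++ v ++ q) :: P2)
                  y1 (ract y z, y2))) }.

Record bimodule (S : Type) (O : operad S) := Bimodule {
  bimod_seq :> colseq S;
  bimod_str :> bimod_struct O bimod_seq }.

Record bimod_map (S : Type) (O : operad S) (M N : bimodule O) := BimodMap {
  bmap :> forall w s, M w s -> N w s;
  bmap_continuous : forall w s, continuous (@bmap w s);
  bmap_ract : forall l a r u s (x : M (l ++ a :: r) s) (y : O u a),
    bmap (ract M x y) = ract N (bmap x) y;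
  bmap_lact : forall w s P (x : O w s) (y : hprod M P w),
    bmap (lact M x y) = lact N x (hmap (@bmap) y) }.

(** * Cubes, weak homotopy equivalences and Serre fibrations *)

Section Homotopy.
Variable R : realType.

Definition unit_itv : set R := `[0%R, 1%R].
Definition I01 : topologicalType := set_type unit_itv.

Lemma zero_in_unit_itv : 0%R \in unit_itv.
Proof. by rewrite inE /unit_itv /= in_itv /= lexx ler01. Qed.

Lemma one_in_unit_itv : 1%R \in unit_itv.
Proof. by rewrite inE /unit_itv /= in_itv /= lexx ler01. Qed.

Definition I0 : I01 := exist (fun x => x \in unit_itv) 0%R zero_in_unit_itv.
Definition I1 : I01 := exist (fun x => x \in unit_itv) 1%R one_in_unit_itv.

Definition cube (n : nat) : topologicalType := {ptws 'I_n -> I01}.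

Definition cube_boundary (n : nat) (t : cube n) : Prop :=
  exists i : 'I_n, t i = I0 \/ t i = I1.

Definition path_joined (X : topologicalType) (x y : X) : Prop :=
  exists g : I01 -> X, [/\ continuous g, g I0 = x & g I1 = y].

(* Representatives of elements of $\pi_n(X,x)$, and the homotopy relation. *)
Definition is_spheroid (n : nat) (X : topologicalType) (x : X)
    (f : cube n -> X) : Prop :=
  continuous f /\ forall t, cube_boundary t -> f t = x.

Definition spheroid_homotopic (n : nat) (X : topologicalType) (x : X)
    (f g : cube n -> X) : Prop :=
  exists H : cube n * I01 -> X,
    [/\ continuous H, forall t, H (t, I0) = f t, forall t, H (t, I1) = g t
      & forall t u, cube_boundary t -> H (t, u) = x].

Definition pi0_bijective (X Y : topologicalType) (f : X -> Y) : Prop :=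
  (forall x x', path_joined (f x) (f x') -> path_joined x x') /\
  (forall y, exists x, path_joined (f x) y).

Definition pi_bijective (n : nat) (X Y : topologicalType) (f : X -> Y) (x : X)
    : Prop :=
  (forall g h : cube n -> X, is_spheroid x g -> is_spheroid x h ->
    spheroid_homotopic (f x) (f \o g) (f \o h) -> spheroid_homotopic x g h) /\
  (forall h : cube n -> Y, is_spheroid (f x) h ->
    exists2 g : cube n -> X, is_spheroid x g &
      spheroid_homotopic (f x) (f \o g) h).

(* The maps induced on $\pi_n$, $n \ge 1$, are automatically group
   homomorphisms. *)
Definition weak_homotopy_equivalence (X Y : topologicalType) (f : X -> Y)
    : Prop :=
  [/\ continuous f, pi0_bijective f
    & forall (n : nat) (x : X), (0 < n)%N -> pi_bijective n f x].

Definition serre_fibration (X Y : topologicalType) (f : X -> Y) : Prop :=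
  continuous f /\
  forall (n : nat) (h : cube n -> X) (H : cube n * I01 -> Y),
    continuous h -> continuous H -> (forall t, H (t, I0) = f (h t)) ->
    exists G : cube n * I01 -> X,
      [/\ continuous G, forall t, G (t, I0) = h t & forall z, f (G z) = H z].

(** * The model structure on bimodules *)

Section ModelStructure.
Variables (S : Type) (O : operad S).
Implicit Types M N A B E X : bimodule O.

Definition bimod_weak_equivalence M N (f : bimod_map M N) : Prop :=
  forall w s, weak_homotopy_equivalence (f w s).

Definition bimod_fibration M N (f : bimod_map M N) : Prop :=
  forall w s, serre_fibration (f w s).

(* In a model category the cofibrations are the maps with the left lifting
   property against the fibrations that are weak equivalences. *)
Definition bimod_cofibration A B (i : bimod_map A B) : Prop :=
  forall E X (p : bimod_map E X) (f : bimod_map A E) (g : bimod_map B X),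
    bimod_fibration p -> bimod_weak_equivalence p ->
    (forall w s x, p w s (f w s x) = g w s (i w s x)) ->
    exists h : bimod_map B E,
      (forall w s x, h w s (i w s x) = f w s x) /\
      (forall w s x, p w s (h w s x) = g w s x).

Definition bimod_initial A : Prop :=
  forall M, exists f : bimod_map A M,
    forall (g : bimod_map A M) w s x, g w s x = f w s x.

Definition bimod_cofibrant M : Prop :=
  exists (A : bimodule O) (i : bimod_map A M),
    bimod_initial A /\ bimod_cofibration i.

Definition cofibrant_replacement M N : Prop :=
  bimod_cofibrant M /\ exists f : bimod_map M N, bimod_weak_equivalence f.

End ModelStructure.
End Homotopy.

Arguments unit_itv : clear implicits.

(** * The operad $\mathcal{A}ct_{>0}$ *)

Inductive colour := col_o | col_c.

Definition colour_eqb (a b : colour) : bool :=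
  match a, b with col_o, col_o | col_c, col_c => true | _, _ => false end.

Lemma colour_eqbP : Equality.axiom colour_eqb.
Proof. by case; case; constructor. Qed.

HB.instance Definition _ := hasDecEq.Build colour colour_eqbP.

(* The profiles $(c,\dots,c;c)$ and $(c,\dots,c,o;o)$ with $n > 0$ inputs. *)
Definition profile (w : seq colour) (s : colour) : bool :=
  match s with
  | col_c => (0 < size w)%N && (w == nseq (size w) col_c)
  | col_o => w == rcons (nseq (size w).-1 col_c) col_o
  end.

Lemma profile_cE w : profile w col_c = (w != [::]) && all (pred1 col_c) w.
Proof.
by rewrite /profile -size_eq0 lt0n (sameP (all_pred1P col_c w) eqP).
Qed.

Lemma profile_oP w :
  reflect (exists2 v, all (pred1 col_c) v & w = rcons v col_o)
          (profile w col_o).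
Proof.
apply: (iffP eqP) => [->|[v /all_pred1P -> ->]].
  by exists (nseq (size w).-1 col_c); rewrite ?all_pred1_nseq ?eqxx ?orbT.
by rewrite size_rcons size_nseq.
Qed.

Lemma profile_comp l a r u s :
  profile (l ++ a :: r) s -> profile u a -> profile (l ++ u ++ r) s.
Proof.
case: s => [/profile_oP[v av]|].
  case/lastP: r => [|r b].
    rewrite cats1 => /rcons_inj[lv ->] /profile_oP[u' au' ->].
    apply/profile_oP; exists (l ++ u'); last by rewrite cats0 rcons_cat.
    rewrite -lv in av.
    by rewrite all_cat av au'.
  rewrite -rcons_cons -rcons_cat => /rcons_inj[ev ->].
  move: av; rewrite -ev all_cat /= => /and3P[al /eqP -> ar].
  rewrite profile_cE => /andP[_ au].
  apply/profile_oP; exists (l ++ u ++ r); last by rewrite -!rcons_cat.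
  by rewrite !all_cat al au ar.
rewrite !profile_cE !all_cat => /andP[_ /and3P[al /eqP -> ar]].
rewrite profile_cE => /andP[u0 au]; apply/andP; split; last by apply/and3P.
by move: u0; rewrite -!size_eq0 !size_cat !addn_eq0 => /negbTE ->; rewrite andbF.
Qed.

(* [T] if [b] holds, and the empty space otherwise. *)
Section Restriction.
Implicit Types (b : bool) (T : space).

Lemma void_hausdorff : hausdorff_space (discrete_space void).
Proof. by case. Qed.

Lemma void_compactly_generated (A : set (discrete_space void)) :
  k_open A -> open A.
Proof. by move=> _; exact: discrete_open. Qed.

Definition void_space : space := Space void_hausdorff void_compactly_generated.

Definition restrict b T : space := if b then T else void_space.

Definition restrict_in b T : b -> T -> restrict b T :=
  match b return b -> T -> restrict b T with
  | true => fun _ x => x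
  | false => fun h _ => match notF h with end
  end.

Definition restrict_val b T : restrict b T -> T :=
  match b return restrict b T -> T with
  | true => fun x => x
  | false => fun x => match (x : void) with end
  end.

Lemma restrictP b T : restrict b T -> b.
Proof. by case: b => // -[]. Qed.

End Restriction.

Lemma point_hausdorff : hausdorff_space (discrete_space unit).
Proof. by case=> -[]. Qed.

Lemma point_compactly_generated (A : set (discrete_space unit)) :
  k_open A -> open A.
Proof. by move=> _; exact: discrete_open. Qed.

Definition point_space : space := Space point_hausdorff point_compactly_generated.

Definition act_seq : colseq colour := fun w s => restrict (profile w s) point_space.

Definition act_elt w s (h : profile w s) : act_seq w s :=
  restrict_in (T := point_space) h tt.

Lemma act_elt_uniq w s (x y : act_seq w s) : x = y.
Proof. by move: x y; rewrite /act_seq; case: profile => -[] // []. Qed.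

Lemma kcontinuous_act (X : topologicalType) w s (f : X -> act_seq w s) :
  kcontinuous f.
Proof.
move=> x U /nbhs_singleton Ufx.
apply: (@filterS _ (nbhs (x : kification X)) _ setT); last exact: filterT.
by move=> y _; rewrite /= (act_elt_uniq (f y) (f x)).
Qed.

Definition act_comp : right_op act_seq act_seq := fun l a r u s x y =>
  act_elt (profile_comp (restrictP x) (restrictP y)).

Lemma profile_unit s : profile [:: s] s.
Proof. by case: s. Qed.

Definition Act : operad colour.
Proof.
apply: (@Operad colour act_seq (fun s => act_elt (profile_unit s)) act_comp);
  by move=> *; first [exact: kcontinuous_act | exact: act_elt_uniq].
Defined.

Lemma profile_flatten w s P :
  profile w s -> hprod act_seq P w -> profile (flatten P) s.
Proof.
have prof_c : forall v Q, all (pred1 col_c) v -> hprod act_seq Q v ->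
    all (pred1 col_c) (flatten Q) && ((v != [::]) ==> (flatten Q != [::])).
  elim=> [|a v IHv] [|q Q] //= /andP[/eqP -> cv] [y ys].
  have /andP[cQ _] := IHv Q cv ys.
  have := restrictP y; rewrite profile_cE => /andP[q0 cq].
  by rewrite all_cat cq cQ /=; case: (q) q0.
case: s => [/profile_oP[v cv ->]|]; last first.
  rewrite !profile_cE => /andP[w0 cw] ys.
  by have := prof_c w P cw ys; rewrite w0 /= andbC.
move=> ys; apply/profile_oP.
elim: v P cv ys => [|a v IHv] [|p P] //=.
- case: P => [|? ?] _ [y //] _.
  by have /profile_oP[u cu ->] := restrictP y; exists u; rewrite ?cats0.
- move=> /andP[/eqP -> cv] [y ys].
  have [u cu ->] := IHv P cv ys.
  have := restrictP y; rewrite profile_cE => /andP[_ cp].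
  by exists (p ++ u); rewrite ?all_cat ?cp ?rcons_cat.
Qed.

(* The components of [Act] have at most one point, so that this is the only
   possible bimodule structure on [act_seq]. *)
Definition Act_bimodule : bimodule Act.
Proof.
apply: (@Bimodule colour Act act_seq).
apply: (@BimodStruct colour Act act_seq act_comp
  (fun w s P x y => act_elt (profile_flatten (restrictP x) y)));
  by move=> *; first [exact: kcontinuous_act | exact: act_elt_uniq].
Defined.

(* $\ast_{2;c}$ and $\ast_{2;o}$ *)
Definition star2c : Act [:: col_c; col_c] col_c :=
  act_elt (w := [:: col_c; col_c]) (s := col_c) isT.
Definition star2o : Act [:: col_c; col_o] col_o :=
  act_elt (w := [:: col_c; col_o]) (s := col_o) isT.

(** * The sequence $\square$ *)

Section Box.
Variable R : realType.

Lemma I01_compact : compact [set: I01 R].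
Proof.
have val_cts : continuous (set_val : I01 R -> R) by exact: initial_continuous.
move=> F PF _.
have Fitv : (set_val @ F) (unit_itv R).
  by apply: (@filterS _ F _ setT) => [x _|]; [exact: set_valP | exact: filterT].
have : compact (unit_itv R) by exact: segment_compact.
move=> /(_ _ _ Fitv) [p [p01 clp]].
exists (exist (fun x => x \in unit_itv R) p (mem_set p01)); split => // A U FA.
case=> _ [[W oW <-] /= Wp sWU].
have [||_ [[x Ax <-] Wx]] := clp (set_val @` A) W.
- by apply: (@filterS _ F _ A) => // x Ax; exists x.
- by apply: open_nbhs_nbhs; split => //; rewrite set_valE in Wp.
- by exists x; split => //; exact: sWU.
Qed.

Lemma I01_hausdorff : hausdorff_space (I01 R).
Proof.
have val_cts : continuous (set_val : I01 R -> R) by exact: initial_continuous.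
move=> p q clpq; apply: val_inj; apply: (@Rhausdorff R) => A B nA nB.
have [x [Ax Bx]] := clpq _ _ (val_cts p A nA) (val_cts q B nB).
by exists (set_val x).
Qed.

Lemma cube_hausdorff n : hausdorff_space (cube R n).
Proof. by apply: hausdorff_product => i; exact: I01_hausdorff. Qed.

Lemma cube_compactly_generated n (A : set (cube R n)) : k_open A -> open A.
Proof.
apply: compact_compactly_generated.
have := @tychonoff 'I_n (fun=> I01 R) (fun=> setT) (fun=> I01_compact).
by congr compact; apply/seteqP.
Qed.

Definition cube_space (n : nat) : space :=
  Space (@cube_hausdorff n) (@cube_compactly_generated n).

Definition box : colseq colour := fun w s =>
  restrict (profile w s) (cube_space (size w).-1).

(* The coordinates $t_1, \dots, t_{n-1}$, in order. *)
Definition coords w s (x : box w s) : seq (I01 R) :=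
  [seq (restrict_val x : cube R (size w).-1) i | i <- enum 'I_(size w).-1].

Section Operations.
Variable B : bimod_struct Act box.

(* $-\circ^{i}\ast_{2;c}$ on $\square(n;c)$, with $n = p + 1 + q$, $i = p + 1$. *)
Definition box_ract_cc : Prop :=
  forall (p q : nat) (x : box (nseq p col_c ++ col_c :: nseq q col_c) col_c),
    coords (ract B x star2c) = take p (coords x) ++ I0 R :: drop p (coords x).

(* $-\circ^{i}\ast_{2;c}$ on $\square(n;o)$, with $n = p + 2 + q$, $i = p + 1$. *)
Definition box_ract_oc : Prop :=
  forall (p q : nat)
    (x : box (nseq p col_c ++ col_c :: rcons (nseq q col_c) col_o) col_o),
    coords (ract B x star2c) = take p (coords x) ++ I0 R :: drop p (coords x).

(* $-\circ^{n}\ast_{2;o}$ on $\square(n;o)$, with $n = p + 1$. *)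
Definition box_ract_oo : Prop :=
  forall (p : nat) (x : box (nseq p col_c ++ [:: col_o]) col_o),
    coords (ract B x star2o) = rcons (coords x) (I0 R).

(* $\ast_{2;c}(-,-)$ *)
Definition box_lact_c : Prop :=
  forall (n m : nat) (x : box (nseq n col_c) col_c)
    (y : box (nseq m col_c) col_c),
    coords (lact B (P := [:: nseq n col_c; nseq m col_c]) star2c (x, (y, tt)))
    = coords x ++ I1 R :: coords y.

(* $\ast_{2;o}(-,-)$ *)
Definition box_lact_o : Prop :=
  forall (n m : nat) (x : box (nseq n col_c) col_c)
    (y : box (rcons (nseq m col_c) col_o) col_o),
    coords (lact B (P := [:: nseq n col_c; rcons (nseq m col_c) col_o])
              star2o (x, (y, tt)))
    = coords x ++ I1 R :: coords y.

Definition box_operations : Prop :=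
  [/\ box_ract_cc, box_ract_oc, box_ract_oo, box_lact_c & box_lact_o].

End Operations.
End Box.

(* Main.v *)
Require Import Defs.
From mathcomp Require Import all_boot all_order all_algebra.
From mathcomp Require Import all_classical all_reals all_analysis.
From mathcomp Require Import ring lra zify.

(** The left and right actions of the two binary generators determine all the
    operations, so uniqueness only requires that the generators act by the given
    formulas.

    Cofibrancy means that a map [g] from the boxes lifts through every trivial
    fibration [p : E -> X] of bimodules, the empty bimodule being initial.  The
    lift is built by induction on the number of inputs.  A face [t_i = 0] of a
    cube is the image of a right action on a smaller cube and a face [t_i = 1]
    the image of a left action on two smaller cubes, so compatibility with the
    operations prescribes the lift on the boundary; the prescriptions agree on
    intersections of two faces by the associativity axioms in [E].  The lift then
    extends over the interior because a Serre fibration that is a weak homotopy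
    equivalence has the right lifting property against the inclusion of the
    boundary of a cube.  Finally the boxes are contractible, hence weakly
    equivalent to the one-point components of [Act]. *)

Set Implicit Arguments.
Unset Strict Implicit.
Unset Printing Implicit Defensive.

Import Order.TTheory GRing.Theory Num.Theory numFieldNormedType.Exports.
Local Open Scope classical_set_scope.

(** * The unit interval and cubes *)

(** The coordinate [t_i] belongs to the gap between the inputs [i] and [i+1]: the value 0 says that
    both enter through a common right action, the value 1 that a left action cuts the word there.
    Two different faces can therefore meet only over different gaps, and on the intersection the two
    prescriptions are two ways of composing the same operations. They agree by the bimodule axioms,
    because [Act] has at most one operation per word and output. Two obstacles shape the proof.
    Serre fibrations are defined by homotopy lifting for whole cubes without boundary conditions, so
    relative lifting needs an explicit retraction of a cube onto its open box. And the operations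
    land over words that are equal only up to a proof, so boxes are compared by their lists of
    coordinates and elements of [E] by [heq]. *)

Section UnitInterval.
Variable R : realType.
Local Notation I := (I01 R).
Local Notation ival := (set_val : I -> R).

Lemma ival_continuous : continuous ival.
Proof. exact: initial_continuous. Qed.

Lemma ival_ge0 (x : I) : (0 <= ival x)%R.
Proof. by have := set_valP x; rewrite /unit_itv /= in_itv /= => /andP[]. Qed.

Lemma ival_le1 (x : I) : (ival x <= 1)%R.
Proof. by have := set_valP x; rewrite /unit_itv /= in_itv /= => /andP[]. Qed.

Lemma ival_inj : injective ival.
Proof. exact: val_inj. Qed.

Lemma clamp_subproof (x : R) : Num.max 0%R (Num.min 1%R x) \in unit_itv R.
Proof.
by rewrite inE /unit_itv /= in_itv /= le_max lexx /= ge_max ler01 ge_min lexx.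
Qed.

(** Homotopies in a cube can thus be written as real formulas; range conditions arise only where a
    value is computed. *)
Definition clamp (x : R) : I := exist (fun x => x \in unit_itv R) _ (clamp_subproof x).

Lemma ival_clamp x : ival (clamp x) = Num.max 0%R (Num.min 1%R x).
Proof. by []. Qed.

Lemma clampK x : (0 <= x <= 1)%R -> ival (clamp x) = x.
Proof. by case/andP=> x0 x1; rewrite ival_clamp (min_r x1) (max_r x0). Qed.

Lemma ivalK (x : I) : clamp (ival x) = x.
Proof. by apply: ival_inj; rewrite clampK // ival_ge0 ival_le1. Qed.

Lemma clamp_le0 x : (x <= 0)%R -> clamp x = I0 R.
Proof.
by move=> x0; apply: ival_inj; rewrite ival_clamp max_l // ge_min x0 orbT.
Qed.

Lemma clamp_ge1 x : (1 <= x)%R -> clamp x = I1 R.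
Proof.
by move=> x1; apply: ival_inj; rewrite ival_clamp min_l // max_r // ler01.
Qed.

Lemma ival0 : ival (I0 R) = 0%R. Proof. by []. Qed.
Lemma ival1 : ival (I1 R) = 1%R. Proof. by []. Qed.

Lemma I0_neq_I1 : I0 R <> I1 R.
Proof. by move=> /(congr1 ival) /eqP; rewrite ival0 ival1 eq_sym oner_eq0. Qed.

Lemma to_I01_continuous (T : topologicalType) (f : T -> I) :
  continuous (fun x => ival (f x)) -> continuous f.
Proof. exact: continuous_comp_initial. Qed.

Lemma clamp_continuous (T : topologicalType) (f : T -> R) :
  continuous f -> continuous (fun x => clamp (f x)).
Proof.
move=> cf; apply: to_I01_continuous => x.
rewrite /=.
apply: (@continuous_max R T (fun=> 0%R) (fun x => Num.min 1%R (f x))).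
  exact: cvg_cst.
apply: (@continuous_min R T (fun=> 1%R) f); [exact: cvg_cst|exact: cf].
Qed.

Lemma closed_I01_set1 (a : I) : closed [set a].
Proof. exact/accessible_closed_set1/hausdorff_accessible/I01_hausdorff. Qed.

Lemma to_cube_continuous (T : topologicalType) n (f : T -> cube R n) :
  (forall i, continuous (fun x => f x i)) -> continuous f.
Proof.
move=> cf x; apply/cvg_sup => i.
by apply: (@continuous_comp_initial _ T I (fun g : 'I_n -> I => g i)); exact: cf.
Qed.

Lemma cube_coord_continuous n (i : 'I_n) : continuous (fun t : cube R n => t i).
Proof. exact: (@proj_continuous 'I_n (fun=> I) i). Qed.

Lemma cube_eq n (s t : cube R n) : (forall i, s i = t i) -> s = t.
Proof. by move=> st; apply: functional_extensionality_dep. Qed.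

Lemma cube0_eq (s t : cube R 0) : s = t.
Proof. by apply: cube_eq => -[]. Qed.

Lemma closed_coord n (i : 'I_n) (a : I) : closed [set t : cube R n | t i = a].
Proof.
apply: (@preimage_closed (cube R n) I (fun t => t i) [set a]).
  by move=> x _; exact: cube_coord_continuous.
exact: closed_I01_set1.
Qed.

Lemma closed_cube_boundary n : closed (@cube_boundary R n).
Proof.
have -> : @cube_boundary R n =
    \big[setU/set0]_(i <- enum 'I_n) ([set t | t i = I0 R] `|` [set t | t i = I1 R]).
  rewrite -bigcup_seq; apply/seteqP; split=> t [i].
    by move=> ti; exists i => //=; rewrite mem_enum.
  by move=> _ ti; exists i.
by apply: closed_bigsetU => i _; apply: closedU; exact: closed_coord.
Qed.

End UnitInterval.

Section ContinuousHelpers.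
Variables (S T U : topologicalType).

Lemma continuous_compose (f : S -> T) (g : T -> U) :
  continuous f -> continuous g -> continuous (fun x => g (f x)).
Proof. by move=> cf cg x; apply: continuous_comp; [exact: cf|exact: cg]. Qed.

Lemma continuous_id : continuous (fun x : S => x).
Proof. by move=> x; exact: cvg_id. Qed.

Lemma continuous_pair (f : S -> T) (g : S -> U) :
  continuous f -> continuous g -> continuous (fun x => (f x, g x)).
Proof. by move=> cf cg x; apply: cvg_pair; [exact: cf|exact: cg]. Qed.

Lemma continuous_fst : continuous (fun x : S * T => x.1).
Proof. by move=> x; exact: cvg_fst. Qed.

Lemma continuous_snd : continuous (fun x : S * T => x.2).
Proof. by move=> x; exact: cvg_snd. Qed.

Lemma within_comp (A : set S) (B : set T) (f : S -> T) (g : T -> U) :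
  {within A, continuous f} -> (forall x, A x -> B (f x)) ->
  {within B, continuous g} -> {within A, continuous (fun x => g (f x))}.
Proof.
move=> /subspace_continuousP cf AB /subspace_continuousP cg.
apply/subspace_continuousP => x Ax V /(cg _ (AB _ Ax)) nV.
have := cf _ Ax _ nV.
rewrite /= !nbhs_simpl /= /within /=; apply: filterS => y h Ay.
exact: h Ay (AB _ Ay).
Qed.

Lemma within_eq (A : set S) (f g : S -> T) :
  (forall x, A x -> f x = g x) ->
  {within A, continuous f} -> {within A, continuous g}.
Proof.
by move=> fg; apply: (@subspace_eq_continuous _ A) => x; rewrite inE; exact: fg.
Qed.

Lemma continuous_withinT (f : S -> T) : {within setT, continuous f} -> continuous f.
Proof.
move=> /subspace_continuousP cf x.
have := cf x I; apply: cvg_trans; apply: cvg_fmap2.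
by move=> V; rewrite /within /=; apply: filterS => y; apply.
Qed.

End ContinuousHelpers.

Lemma continuous_comp_within (S T U : topologicalType) (B : set T) (f : S -> T) (g : T -> U) :
  continuous f -> (forall x, B (f x)) -> {within B, continuous g} ->
  continuous (fun x => g (f x)).
Proof.
move=> cf fB cg; apply: continuous_withinT.
apply: (within_comp (B := B)) => //; exact: continuous_subspaceT.
Qed.

(** * Homotopy lifting relative to the boundary of a cube *)

Section RealContinuity.
Variables (R : realType) (T : topologicalType).
Implicit Types f g : T -> R.
Local Open Scope ring_scope.

Lemma continuous_cstR (c : R) : continuous (fun _ : T => c).
Proof. exact: cst_continuous. Qed.

Lemma continuous_subR f g :
  continuous f -> continuous g -> continuous (fun x => f x - g x).
Proof. by move=> cf cg x; apply: cvgB; [exact: cf|exact: cg]. Qed.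

Lemma continuous_addR f g :
  continuous f -> continuous g -> continuous (fun x => f x + g x).
Proof. by move=> cf cg x; apply: cvgD; [exact: cf|exact: cg]. Qed.

Lemma continuous_mulR f g :
  continuous f -> continuous g -> continuous (fun x => f x * g x).
Proof. by move=> cf cg x; apply: cvgM; [exact: cf|exact: cg]. Qed.

Lemma continuous_invR f :
  (forall x, f x != 0) -> continuous f -> continuous (fun x => (f x)^-1).
Proof. by move=> f0 cf x; apply: cvgV; [exact: f0|exact: cf]. Qed.

Lemma continuous_maxR f g :
  continuous f -> continuous g -> continuous (fun x => Num.max (f x) (g x)).
Proof.
by move=> cf cg x; apply: (@continuous_max R T f g); [exact: cf|exact: cg].
Qed.

Lemma continuous_normR f : continuous f -> continuous (fun x => `|f x|).
Proof. by move=> cf x; apply: cvg_norm; exact: cf. Qed.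

End RealContinuity.

Section RelativeHomotopyLifting.
Variable R : realType.
Local Notation I := (I01 R).
Local Notation ival := (set_val : I -> R).
Local Open Scope ring_scope.

(** * Retraction of a cube onto its open box *)

Section BoxRetraction.
Variable n : nat.
Implicit Types z : cube R n.+1.

Definition open_box : set (cube R n.+1) :=
  [set z | z ord0 = I0 R \/ exists j, j != ord0 /\ (z j = I0 R \/ z j = I1 R)].

(** The inverse of the factor by which [z - (2, 1/2, ..., 1/2)] must be stretched to reach the face
    [z ord0 = 0], respectively the nearer of the two faces in direction [j]. The face reached first
    has the smallest factor, hence the maximum in [gauge]. *)
Definition gauge_coord z (j : 'I_n.+1) : R :=
  if j == ord0 then 1 - ival (z j) / 2 else `|2 * ival (z j) - 1|.

Definition gauge z : R := \big[Num.max/0]_(j <- enum 'I_n.+1) gauge_coord z j.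

Lemma gauge_coord_le1 z j : gauge_coord z j <= 1.
Proof.
have := ival_ge0 (z j); have := ival_le1 (z j).
rewrite /gauge_coord; case: eqP => _ a b; first by lra.
by rewrite ler_norml; apply/andP; split; lra.
Qed.

Lemma gauge_coord_le z j : gauge_coord z j <= gauge z.
Proof. by apply: le_bigmax_seq => //; rewrite mem_enum. Qed.

Lemma gauge_le1 z : gauge z <= 1.
Proof. by apply: bigmax_le => // j _; exact: gauge_coord_le1. Qed.

(** This bound comes from the height 2 of the centre; it keeps [(gauge z)^-1 - 1] in the unit
    interval, so that [radial_time] really takes this value. *)
Lemma gauge_ge z : 1 / 2 <= gauge z.
Proof.
apply: le_trans (gauge_coord_le z ord0).
by rewrite /gauge_coord eqxx; have := ival_le1 (z ord0); lra.
Qed.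

Lemma gauge_gt0 z : 0 < gauge z.
Proof. by have := gauge_ge z; lra. Qed.

Lemma gauge_attained z : exists j, gauge_coord z j = gauge z.
Proof.
have [//|h] := pselect (exists j, gauge_coord z j = gauge z).
have : gauge z < gauge z; last by rewrite ltxx.
rewrite {1}/gauge; apply: bigmax_lt; first exact: gauge_gt0.
move=> j _; rewrite lt_neqAle gauge_coord_le andbT.
by apply/eqP => e; apply: h; exists j.
Qed.

Lemma gauge_open_box z : open_box z -> gauge z = 1.
Proof.
move=> zA; apply/eqP; rewrite eq_le gauge_le1 /=.
suff [j <-] : exists j, gauge_coord z j = 1 by exact: gauge_coord_le.
case: zA => [z0|[j [j0 zj]]].
  by exists ord0; rewrite /gauge_coord eqxx z0 ival0 mul0r subr0.
exists j; rewrite /gauge_coord (negbTE j0); case: zj => ->.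
  by rewrite ival0 mulr0 sub0r normrN1.
by rewrite ival1 mulr1 (_ : 2 - 1 = 1) ?normr1 //; ring.
Qed.

Lemma gauge_continuous : continuous gauge.
Proof.
rewrite /gauge; elim: (enum _) => [|j s IHs].
  under eq_fun do rewrite big_nil.
  exact: continuous_cstR.
under eq_fun do rewrite big_cons.
apply: continuous_maxR IHs.
have cj : continuous (fun z : cube R n.+1 => ival (z j)).
  apply: (@continuous_compose (cube R n.+1) I R (fun z => z j) ival).
    exact: cube_coord_continuous.
  exact: ival_continuous.
rewrite /gauge_coord; case: (j == ord0).
  apply: continuous_subR; first exact: continuous_cstR.
  by apply: continuous_mulR cj _; exact: continuous_cstR.
apply: continuous_normR; apply: continuous_subR; last exact: continuous_cstR.
by apply: continuous_mulR cj; exact: continuous_cstR.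
Qed.

(* Radial projection of [z - (2, 1/2, ..., 1/2)] from the point with height
   [2] over the centre of the base meets [open_box] at scaling factor
   [(gauge z)^-1]; the scaling factor then decreases to [1] in time [t]. *)
Definition scaling (zt : cube R n.+1 * I) : R :=
  Num.max 1 ((gauge zt.1)^-1 - ival zt.2).

Definition radial (zt : cube R n.+1 * I) : cube R n.+1 := fun j =>
  if j == ord0 then clamp (2 - (2 - ival (zt.1 j)) * scaling zt)
  else clamp (1 / 2 + (ival (zt.1 j) - 1 / 2) * scaling zt).

Definition radial_time z : I := clamp ((gauge z)^-1 - 1).

Lemma gaugeV_continuous : continuous (fun z => (gauge z)^-1).
Proof.
apply: continuous_invR gauge_continuous => z.
by rewrite gt_eqF ?gauge_gt0.
Qed.

Lemma scaling_continuous : continuous scaling.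
Proof.
apply: continuous_maxR; first exact: continuous_cstR.
apply: continuous_subR.
  exact: (continuous_compose (@continuous_fst _ _) gaugeV_continuous).
exact: (continuous_compose (@continuous_snd _ _) (@ival_continuous R)).
Qed.

Lemma radial_continuous : continuous radial.
Proof.
apply: to_cube_continuous => j.
have cj : continuous (fun zt : cube R n.+1 * I => ival (zt.1 j)).
  apply: (@continuous_compose _ I R (fun z : cube R n.+1 * I => z.1 j) ival); last exact: ival_continuous.
  exact: (continuous_compose (@continuous_fst _ _) (@cube_coord_continuous R n.+1 j)).
have c1 := @continuous_cstR R (cube R n.+1 * I)%type.
rewrite /radial; case: (j == ord0); apply: clamp_continuous.
  apply: continuous_subR (c1 _) _.
  by apply: continuous_mulR scaling_continuous; exact: continuous_subR.
apply: continuous_addR (c1 _) _.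
by apply: continuous_mulR scaling_continuous; exact: continuous_subR.
Qed.

Lemma radial_time_continuous : continuous radial_time.
Proof.
apply: clamp_continuous; apply: continuous_subR gaugeV_continuous _.
exact: continuous_cstR.
Qed.

Lemma gaugeV_bounds z : 1 <= (gauge z)^-1 <= 2.
Proof.
have g0 := gauge_gt0 z; have g1 := gauge_le1 z; have g2 := gauge_ge z.
rewrite invf_ge1 // g1 /= -[leRHS]invrK lef_pV2 ?posrE ?invr_gt0 ?ltr0n //.
by rewrite -div1r.
Qed.

Lemma radial_timeE z : radial (z, radial_time z) = z.
Proof.
have /andP[g1 g2] := gaugeV_bounds z.
have s1 : scaling (z, radial_time z) = 1.
  rewrite /scaling /= /radial_time clampK; last by apply/andP; split; lra.
  by rewrite opprB addrCA subrr addr0 maxxx.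
apply: cube_eq => j; rewrite /radial s1 /=; case: (j == ord0).
  by rewrite mulr1 opprB addrCA subrr addr0 ivalK.
by rewrite mulr1 addrCA subrr addr0 ivalK.
Qed.

Lemma radial_open_box z : open_box z -> radial (z, I0 R) = z.
Proof.
move=> zA; rewrite -{2}(radial_timeE z); congr (radial (_, _)).
by rewrite /radial_time gauge_open_box // invr1 subrr clamp_le0.
Qed.

(** A coordinate attaining the maximum in [gauge] lands on a face, and [open_box] asks nothing of
    the others. In a direction [j != ord0] the sign of [2 * z j - 1] decides which of the two faces
    it is. *)
Lemma open_box_radial z : open_box (radial (z, I0 R)).
Proof.
have /andP[g1 g2] := gaugeV_bounds z; have g0 := gauge_gt0 z.
have sE : scaling (z, I0 R) = (gauge z)^-1.
  by rewrite /scaling /= ival0 subr0 max_r.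
have [j] := gauge_attained z; rewrite /gauge_coord.
have [->|j0] := eqVneq j ord0 => e.
  left; rewrite /radial eqxx sE /= clamp_le0 //.
  rewrite -e; have e0 : 1 - ival (z ord0) / 2 != 0 by rewrite e gt_eqF.
  have -> : 2 - ival (z ord0) = 2 * (1 - ival (z ord0) / 2) by field.
  by rewrite mulfK // subrr.
right; exists j; split => //; rewrite /radial (negbTE j0) sE /=.
have gV : gauge z * (gauge z)^-1 = 1 by rewrite mulfV ?gt_eqF.
case: (lerP 0 (2 * ival (z j) - 1)) => h.
  right; apply: clamp_ge1; move: e; rewrite ger0_norm // => e.
  have -> : ival (z j) - 1 / 2 = gauge z / 2 by move: e; clear; lra.
  by rewrite mulrAC gV; lra.
left; apply: clamp_le0; move: e; rewrite ltr0_norm // => e.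
have -> : ival (z j) - 1 / 2 = - (gauge z / 2) by move: e; clear; lra.
by rewrite mulNr mulrAC gV; lra.
Qed.

End BoxRetraction.
End RelativeHomotopyLifting.

(** The map [a] is total but only its restriction to [A] matters, so partial maps need no type for
    the subspace. *)
Definition lifts_from (Z E X : topologicalType) (A : set Z) (p : E -> X) : Prop :=
  forall (a : Z -> E) (b : Z -> X),
    {within A, continuous a} -> continuous b -> (forall z, A z -> p (a z) = b z) ->
    exists h, [/\ continuous h, forall z, A z -> h z = a z & forall z, p (h z) = b z].

Section SerreFibration.
Variables (R : realType) (E X : topologicalType) (p : E -> X).
Hypothesis pS : serre_fibration R p.

(* The inclusion of [open_box] is a retract of [Z * {0} -> Z * I], [Z] the
   whole cube, hence inherits the homotopy lifting property of [Z]. *)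
Lemma open_box_lift n : lifts_from (@open_box R n) p.
Proof.
move=> a b ca cb pab.
have [|||G [cG G0 pG]] := (pS.2 n.+1 (fun z => a (radial (z, I0 R)))
    (fun zt => b (radial zt))).
- apply: continuous_comp_within ca; last by move=> z; exact: open_box_radial.
  apply: (continuous_compose _ (@radial_continuous R n)).
  exact: continuous_pair (@continuous_id _) (@cst_continuous _ _ _).
- exact: continuous_compose (@radial_continuous R n) cb.
- by move=> z; rewrite pab //; exact: open_box_radial.
exists (fun z => G (z, radial_time z)); split.
- apply: (continuous_compose _ cG); apply: continuous_pair; first exact: continuous_id.
  exact: radial_time_continuous.
- move=> z zA; rewrite -[X in a X]radial_open_box // -G0; congr (G (_, _)).
  by rewrite /radial_time gauge_open_box // invr1 subrr clamp_le0.
- by move=> z; rewrite pG radial_timeE.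
Qed.

End SerreFibration.

(** * The homotopy parameter as an extra coordinate *)

Section CubeOperations.
Variable R : realType.
Local Notation I := (I01 R).
Local Notation ival := (set_val : I -> R).

Definition ccons n (s : I) (t : cube R n) : cube R n.+1 :=
  fun j => if unlift ord0 j is Some i then t i else s.

Definition ctail n (z : cube R n.+1) : cube R n := fun i => z (lift ord0 i).

Lemma ccons0 n s (t : cube R n) : ccons s t ord0 = s.
Proof. by rewrite /ccons unlift_none. Qed.

Lemma cconsK n s (t : cube R n) : ctail (ccons s t) = t.
Proof. by apply: cube_eq => i; rewrite /ctail /ccons liftK. Qed.

Lemma ccons_eta n (z : cube R n.+1) : ccons (z ord0) (ctail z) = z.
Proof. by apply: cube_eq => j; rewrite /ccons /ctail; case: unliftP => [i|] ->. Qed.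

Lemma ccons_continuous (T : topologicalType) n (f : T -> I) (g : T -> cube R n) :
  continuous f -> continuous g -> continuous (fun x => ccons (f x) (g x)).
Proof.
move=> cf cg; apply: to_cube_continuous => j; rewrite /ccons.
case: (unlift ord0 j) => [i|//].
exact: (continuous_compose cg (@cube_coord_continuous R n i)).
Qed.

Lemma ctail_continuous n : continuous (@ctail n).
Proof. by apply: to_cube_continuous => i; exact: cube_coord_continuous. Qed.

Lemma open_boxE n (z : cube R n.+1) :
  open_box z <-> z ord0 = I0 R \/ cube_boundary (ctail z).
Proof.
split=> [[|[j [j0 zj]]]|[|[i zi]]]; [by left| |by left|].
  right; move: j0 zj; case: (unliftP ord0 j) => [i -> _ zi|->]; last by rewrite eqxx.
  by exists i.
by right; exists (lift ord0 i); rewrite eq_sym neq_lift.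
Qed.

Lemma cube_boundaryE n (z : cube R n.+1) :
  cube_boundary z <-> z ord0 = I1 R \/ open_box z.
Proof.
rewrite open_boxE; split=> [[j]|[z1|[z0|[i zi]]]].
- case: (unliftP ord0 j) => [i ->|->] h; first by right; right; exists i.
  by case: h => h; [right; left|left].
- by exists ord0; right.
- by exists ord0; left.
- by exists (lift ord0 i).
Qed.

Lemma closed_open_box n : closed (@open_box R n).
Proof.
have -> : @open_box R n = [set z | z ord0 = I0 R] `|` @ctail n @^-1` (@cube_boundary R n).
  by apply/seteqP; split=> z /open_boxE.
apply: closedU; first exact: closed_coord.
apply: preimage_closed; last exact: closed_cube_boundary.
by move=> z _; exact: ctail_continuous.
Qed.

Definition irev (x : I) : I := clamp (1 - ival x)%R.

Lemma ival_irev x : ival (irev x) = (1 - ival x)%R.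
Proof.
by apply: clampK; have := ival_ge0 x; have := ival_le1 x; rewrite subr_ge0 => -> ?; lra.
Qed.

Lemma irevK x : irev (irev x) = x.
Proof. by apply: ival_inj; rewrite !ival_irev subKr. Qed.

Lemma irev0 : irev (I0 R) = I1 R.
Proof. by apply: ival_inj; rewrite ival_irev ival0 ival1 subr0. Qed.

Lemma irev1 : irev (I1 R) = I0 R.
Proof. by rewrite -irev0 irevK. Qed.

Lemma irev_continuous : continuous irev.
Proof.
apply: clamp_continuous; apply: continuous_subR; first exact: continuous_cstR.
exact: ival_continuous.
Qed.

Definition corner n : cube R n := fun _ => I0 R.
Arguments corner : clear implicits.

Definition contract n (z : cube R n) (u : I) : cube R n :=
  fun j => clamp (ival (z j) * ival u)%R.

Lemma contract1 n (z : cube R n) : contract z (I1 R) = z.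
Proof. by apply: cube_eq => j; rewrite /contract ival1 mulr1 ivalK. Qed.

Lemma contract0 n (z : cube R n) : contract z (I0 R) = corner n.
Proof. by apply: cube_eq => j; rewrite /contract ival0 mulr0 clamp_le0. Qed.

Lemma contract_continuous (T : topologicalType) n (f : T -> cube R n) (g : T -> I) :
  continuous f -> continuous g -> continuous (fun x => contract (f x) (g x)).
Proof.
move=> cf cg; apply: to_cube_continuous => j; apply: clamp_continuous.
apply: continuous_mulR; last exact: (continuous_compose cg (@ival_continuous R)).
apply: (@continuous_compose T I R (fun x => f x j) ival); last exact: ival_continuous.
exact: (continuous_compose cf (@cube_coord_continuous R n j)).
Qed.

End CubeOperations.
Arguments corner : clear implicits.

(** * Trivial fibrations *)

Section TrivialFibration.
Variables (R : realType).
Local Notation I := (I01 R).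

(** With time as the coordinate [ord0], the data at time 0 and over the boundary are the bottom and
    the sides of a cube of one dimension more. They glue to a map on its open box, where
    [open_box_lift] applies. *)
Lemma relative_homotopy_lift (E X : topologicalType) (p : E -> X) n
    (a0 : cube R n -> E) (a1 : cube R n * I -> E) (b : cube R n * I -> X) :
  serre_fibration R p -> continuous a0 ->
  {within [set z | cube_boundary z.1], continuous a1} -> continuous b ->
  (forall t, cube_boundary t -> a1 (t, I0 R) = a0 t) ->
  (forall t, p (a0 t) = b (t, I0 R)) ->
  (forall t u, cube_boundary t -> p (a1 (t, u)) = b (t, u)) ->
  exists h : cube R n * I -> E,
    [/\ continuous h, forall t, h (t, I0 R) = a0 t,
        forall t u, cube_boundary t -> h (t, u) = a1 (t, u) & forall z, p (h z) = b z].
Proof.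
move=> pS ca0 ca1 cb a10 pa0 pa1.
pose f (z : cube R n.+1) := (ctail z, z ord0).
have cf : continuous f.
  by apply: continuous_pair; [exact: ctail_continuous|exact: cube_coord_continuous].
pose a (z : cube R n.+1) := if pselect (z ord0 = I0 R) then a0 (ctail z) else a1 (f z).
have aE z : cube_boundary (ctail z) -> a z = a1 (f z).
  by rewrite /a /f => bz; case: pselect => //= z0; rewrite z0 a10.
have [|||h [ch ha ph]] := open_box_lift pS (n := n) (a := a) (b := fun z => b (f z)).
- have -> : @open_box R n =
      [set z | z ord0 = I0 R] `|` @ctail R n @^-1` (@cube_boundary R n).
    by apply/seteqP; split=> z /open_boxE.
  apply: withinU_continuous.
  + exact: closed_coord.
  + apply: preimage_closed; last exact: closed_cube_boundary.
    by move=> z _; exact: ctail_continuous.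
  + apply: (@within_eq _ _ _ (fun z => a0 (ctail z))).
      by move=> z /= z0; rewrite /a; case: pselect.
    apply: continuous_subspaceT.
    exact: (continuous_compose (@ctail_continuous R n) ca0).
  + apply: (@within_eq _ _ _ (fun z => a1 (f z))).
      by move=> z /= bz; rewrite aE.
    apply: within_comp ca1; last by [].
    exact: continuous_subspaceT.
- exact: (continuous_compose cf cb).
- move=> z; rewrite open_boxE /a /f; case: pselect => /= [z0 _|z0 [//|bz]].
    by rewrite pa0 z0.
  by rewrite pa1.
have hE t u : b (t, u) = b (f (ccons u t)) by rewrite /f cconsK ccons0.
exists (fun tu => h (ccons tu.2 tu.1)); split => /=.
- apply: (continuous_compose _ ch).
  exact: (ccons_continuous (@continuous_snd _ _) (@continuous_fst _ _)).
- move=> t; rewrite ha; last by apply/open_boxE; left; rewrite ccons0.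
  by rewrite /a ccons0 cconsK; case: pselect.
- move=> t u bt; rewrite ha; last by apply/open_boxE; right; rewrite cconsK.
  by rewrite aE /f ?cconsK ?ccons0.
- by case=> t u; rewrite ph; exact: esym (hE t u).
Qed.

(** Needed because [contract] is the identity at time 1, so this is where the original data sit. *)
Lemma relative_homotopy_lift1 (E X : topologicalType) (p : E -> X) n
    (a0 : cube R n -> E) (a1 : cube R n * I -> E) (b : cube R n * I -> X) :
  serre_fibration R p -> continuous a0 ->
  {within [set z | cube_boundary z.1], continuous a1} -> continuous b ->
  (forall t, cube_boundary t -> a1 (t, I1 R) = a0 t) ->
  (forall t, p (a0 t) = b (t, I1 R)) ->
  (forall t u, cube_boundary t -> p (a1 (t, u)) = b (t, u)) ->
  exists h : cube R n * I -> E,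
    [/\ continuous h, forall t, h (t, I1 R) = a0 t,
        forall t u, cube_boundary t -> h (t, u) = a1 (t, u) & forall z, p (h z) = b z].
Proof.
move=> pS ca0 ca1 cb a10 pa0 pa1.
pose r (z : cube R n * I) := (z.1, irev z.2).
have cr : continuous r.
  by apply: continuous_pair (@continuous_fst _ _) (continuous_compose (@continuous_snd _ _) (@irev_continuous R)).
have rr z : r (r z) = z by case: z => t u; rewrite /r irevK.
have [|||||h [ch h0 h1 ph]] := relative_homotopy_lift
    (a1 := fun z => a1 (r z)) (b := fun z => b (r z)) pS ca0.
- by apply: within_comp ca1; [exact: continuous_subspaceT|].
- exact: (continuous_compose cr cb).
- by move=> t bt; rewrite /r irev0 a10.
- by move=> t; rewrite /r irev0 pa0.
- by move=> t u bt; rewrite /r pa1.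
exists (fun z => h (r z)); split.
- exact: (continuous_compose cr ch).
- by move=> t; rewrite /r irev1 h0.
- by move=> t u bt; rewrite -[in RHS](rr (t, u)) /r /= h1.
- by move=> z; rewrite ph rr.
Qed.

(** Turns homotopy extension into homotopy lifting over a point. *)
Lemma serre_fibration_terminal (X : topologicalType) :
  serre_fibration R (fun _ : X => tt : discrete_space unit).
Proof.
split; first exact: cst_continuous.
move=> n h H ch cH _; exists (fun z => h z.1); split=> //.
  exact: (continuous_compose (@continuous_fst _ _) ch).
by move=> z; case: (H z).
Qed.

Lemma homotopy_extension1 (X : topologicalType) n
    (a0 : cube R n -> X) (a1 : cube R n * I -> X) :
  continuous a0 -> {within [set z | cube_boundary z.1], continuous a1} ->
  (forall t, cube_boundary t -> a1 (t, I1 R) = a0 t) ->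
  exists h : cube R n * I -> X,
    [/\ continuous h, forall t, h (t, I1 R) = a0 t &
        forall t u, cube_boundary t -> h (t, u) = a1 (t, u)].
Proof.
move=> ca0 ca1 a10.
have [||//|//|h [ch h0 h1 _]] := relative_homotopy_lift1
  (b := fun=> (tt : discrete_space unit)) (serre_fibration_terminal X) ca0 ca1.
- exact: cst_continuous.
- exact: a10.
by exists h.
Qed.

Variables (E X : topologicalType) (p : E -> X).
Hypothesis pS : serre_fibration R p.

(** Solvability of a lifting problem is invariant under deformation: [phi] moves the boundary data
    over the motion [g] of the base map, and a solution [h0] at time 0 is carried to one at time
    1. *)
Lemma homotopic_lift n (phi : cube R n * I -> E) (g : cube R n * I -> X)
    (h0 : cube R n -> E) :
  {within [set z | cube_boundary z.1], continuous phi} -> continuous g ->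
  (forall t u, cube_boundary t -> p (phi (t, u)) = g (t, u)) ->
  continuous h0 -> (forall t, cube_boundary t -> h0 t = phi (t, I0 R)) ->
  (forall t, p (h0 t) = g (t, I0 R)) ->
  exists h : cube R n -> E,
    [/\ continuous h, forall t, cube_boundary t -> h t = phi (t, I1 R)
      & forall t, p (h t) = g (t, I1 R)].
Proof.
move=> cphi cg pphi ch0 h0phi ph0.
have [|h [ch _ hphi ph]] := relative_homotopy_lift pS ch0 cphi cg _ ph0 pphi.
  by move=> t bt; rewrite h0phi.
exists (fun t => h (t, I1 R)); split.
- by apply: (continuous_compose _ ch); exact: continuous_pair (@continuous_id _) (@cst_continuous _ _ _).
- by move=> t bt; rewrite hphi.
- by move=> t; rewrite ph.
Qed.

Hypothesis pW : weak_homotopy_equivalence R p.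

(** Injectivity on the m-th homotopy set, applied to [alpha] and the constant map, whose images in
    [X] are equal. For [m = 0] the cube is a point and the statement is about paths. *)
Lemma null_homotopy m (e : E) (alpha : cube R m -> E) :
  continuous alpha -> (forall t, cube_boundary t -> alpha t = e) ->
  (forall t, p (alpha t) = p e) ->
  exists K : cube R m * I -> E,
    [/\ continuous K, forall t, K (t, I0 R) = e, forall t, K (t, I1 R) = alpha t
      & forall t u, cube_boundary t -> K (t, u) = e].
Proof.
case: pW => _ [pi0 _] pin; case: m alpha => [|m] alpha calpha bd palpha.
  have [|g [cg g0 g1]] := pi0 e (alpha (corner R 0)).
    by exists (fun=> p e); split => //; exact: cst_continuous.
  exists (fun z => g z.2); split=> //.
  - exact: (continuous_compose (@continuous_snd _ _) cg).
  - by move=> t; rewrite (cube0_eq t (corner R 0)).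
  - by move=> t u [[]].
have [inj _] := pin m.+1 e isT.
apply: (inj (fun=> e) alpha); [by split; first exact: cst_continuous|by []|].
exists (fun=> p e); split=> //; first exact: cst_continuous.
by move=> t; rewrite /= palpha.
Qed.

(* The lifting problem [(a, b)] is deformed in two stages to one that is constant
   on the boundary, where surjectivity on [pi_(m+1)] applies, and the solution is
   transported back by [homotopic_lift].  First [b] is contracted to a corner:
   a lift [k] of [b] agreeing with [a] on [open_box] and a lift [L] over the
   remaining face carry [a] along, and at the end [a] is constant outside that
   face.  Injectivity on [pi_m] then extends it to a map [K] on the whole cube,
   and contracting the domain of [K] makes it constant. *)
Theorem trivial_fibration_lift n : lifts_from (@cube_boundary R n) p.
Proof.
move=> a b ca cb pab; case: n a b ca cb pab => [|m] a b ca cb pab.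
  (* The boundary is empty: surjectivity on path components gives a point over some point joined to
     the target, and lifting the path moves it into the right fibre. *)
  case: pW => _ [_ /(_ (b (corner R 0)))[x [g [cg g0 g1]]] _].
  have [||//|G [cG G0 pG]] := pS.2 0%N (fun=> x) (fun z => g z.2).
  - exact: cst_continuous.
  - exact: (continuous_compose (@continuous_snd _ _) cg).
  exists (fun t => G (t, I1 R)); split.
  - by apply: (continuous_compose _ cG); exact: continuous_pair (@continuous_id _) (@cst_continuous _ _ _).
  - by move=> t [[]].
  - by move=> t; rewrite pG g1 (cube0_eq (corner R 0) t).
pose ctr (z : cube R m.+1 * I) := contract z.1 z.2.
have cctr : continuous ctr := contract_continuous (@continuous_fst _ _) (@continuous_snd _ _).
have [|k [ck ka pk]] := open_box_lift pS _ cb (fun z zb => pab z ((cube_boundaryE z).2 (or_intror zb))).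
  by apply: continuous_subspaceW ca => z zb; apply/cube_boundaryE; right.
have cc1 : continuous (@ccons R m (I1 R)) := ccons_continuous (@cst_continuous _ _ _) (@continuous_id _).
have bd1 t : cube_boundary (@ccons R m (I1 R) t).
  by apply/cube_boundaryE; left; rewrite ccons0.
pose f1 (z : cube R m * I) := contract (ccons (I1 R) z.1) z.2.
have cf1 : continuous f1.
  exact: (contract_continuous (continuous_compose (@continuous_fst _ _) cc1) (@continuous_snd _ _)).
have [||||||L [cL L1 Lbd pL]] := relative_homotopy_lift1
    (a0 := fun t => a (ccons (I1 R) t)) (a1 := fun z => k (f1 z)) (b := fun z => b (f1 z)) pS.
- exact: continuous_comp_within cc1 bd1 ca.
- exact: continuous_subspaceT (continuous_compose cf1 ck).
- exact: continuous_compose cf1 cb.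
- move=> t bt; rewrite /f1 contract1 ka //.
  by apply/open_boxE; right; rewrite cconsK.
- by move=> t; rewrite /f1 contract1 pab.
- by move=> t u _; rewrite pk.
(* On the boundary, [Phi] is [a] at time 1; at time 0 it is the constant [e] on the open box and the
   spheroid [L (_, I0)] on the remaining face. *)
pose Phi (z : cube R m.+1 * I) : E :=
  if pselect (z.1 ord0 = I1 R) then L (ctail z.1, z.2) else k (ctr z).
have Phi_open z u : open_box z -> Phi (z, u) = k (ctr (z, u)).
  move=> zb; rewrite /Phi; case: pselect => //= z1.
  case/open_boxE: (zb) => [z0|bz]; first by case: (@I0_neq_I1 R); rewrite -z0 -z1.
  by rewrite Lbd // /f1 /ctr /= -z1 ccons_eta.
have cPhi : {within [set z | cube_boundary z.1], continuous Phi}.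
  have -> : [set z : cube R m.+1 * I | cube_boundary z.1] =
      [set z | z.1 ord0 = I1 R] `|` fst @^-1` (@open_box R m).
    by apply/seteqP; split=> z /= /cube_boundaryE.
  apply: withinU_continuous.
  - apply: (@preimage_closed _ _ fst [set t : cube R m.+1 | t ord0 = I1 R]).
      by move=> z _; exact: continuous_fst.
    exact: closed_coord.
  - apply: preimage_closed; last exact: closed_open_box.
    by move=> z _; exact: continuous_fst.
  - apply: (@within_eq _ _ _ (fun z => L (ctail z.1, z.2))).
      by move=> z /= z1; rewrite /Phi; case: pselect.
    apply: continuous_subspaceT; apply: (continuous_compose _ cL).
    apply: continuous_pair (@continuous_snd _ _).
    exact: (continuous_compose (@continuous_fst _ _) (@ctail_continuous R m)).
  - apply: (@within_eq _ _ _ (fun z => k (ctr z))).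
      by move=> [z u] /= zb; rewrite Phi_open.
    exact: continuous_subspaceT (continuous_compose cctr ck).
have pPhi z u : p (Phi (z, u)) = b (ctr (z, u)).
  rewrite /Phi; case: pselect => /= [z1|_]; last by rewrite pk.
  by rewrite pL /f1 /= -z1 ccons_eta.
have Phi1 z : cube_boundary z -> Phi (z, I1 R) = a z.
  move=> /cube_boundaryE; have [z1 _|z1 [//|zb]] := pselect (z ord0 = I1 R).
    by rewrite /Phi; case: pselect => //= _; rewrite L1 -z1 ccons_eta.
  by rewrite Phi_open // /ctr contract1 ka.
pose e := k (corner R m.+1).
have pe : p e = b (corner R m.+1) by rewrite pk.
have [|||K [cK K0 K1 Kbd]] := null_homotopy (e := e) (alpha := fun t => L (t, I0 R)).
- by apply: (continuous_compose _ cL); exact: continuous_pair (@continuous_id _) (@cst_continuous _ _ _).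
- by move=> t bt; rewrite Lbd // /f1 contract0.
- by move=> t; rewrite pL /f1 contract0 pe.
pose K' (z : cube R m.+1) := K (ctail z, z ord0).
have cK' : continuous K'.
  apply: (continuous_compose _ cK); apply: continuous_pair; first exact: ctail_continuous.
  exact: cube_coord_continuous.
(* The corner lies on the bottom face, where [K] is at its constant end. *)
have K'o : K' (corner R m.+1) = e by rewrite /K' K0.
have K'Phi z : cube_boundary z -> K' z = Phi (z, I0 R).
  move=> /cube_boundaryE; have [z1 _|z1 [//|zb]] := pselect (z ord0 = I1 R).
    by rewrite /Phi /K'; case: pselect => //= _; rewrite z1 K1.
  rewrite Phi_open // /ctr contract0 /K'.
  by case/open_boxE: zb => [->|bz]; [rewrite K0|rewrite Kbd].
have pK' z : cube_boundary z -> p (K' z) = p e.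
  by move=> bz; rewrite K'Phi // pPhi /ctr contract0 pe.
(* Contracting the domain makes [K'] constant on the boundary, but moves its image in [X]. Extending
   this motion over the whole cube from the constant map at time 1 yields at time 0 a spheroid at
   [p e], possibly essential; surjectivity on homotopy groups lifts it up to homotopy. *)
have [|||G2 [cG2 G21 G2bd]] := homotopy_extension1
    (a0 := fun _ : cube R m.+1 => p e) (a1 := fun z => p (K' (ctr z))).
- exact: cst_continuous.
- apply: continuous_subspaceT; apply: (continuous_compose _ pS.1).
  exact: (continuous_compose cctr cK').
- by move=> t bt; rewrite /ctr contract1 pK'.
have [_ /(_ (fun z => G2 (z, I0 R)))[]] : pi_bijective R m.+1 p e by case: pW => _ _; apply.
  split; last by move=> z bz; rewrite G2bd // /ctr contract0 K'o.
  by apply: (continuous_compose _ cG2); exact: continuous_pair (@continuous_id _) (@cst_continuous _ _ _).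
move=> v [cv vbd] [H [cH H0 H1 Hbd]].
(* The three deformations are now traversed one after another, from [v] back to [b]: the boundary
   data are [e] along [H], then [K'] contracted along [G2], then [Phi]. *)
have [||||||h1 [ch1 h1bd ph1]] := homotopic_lift (phi := fun=> e) (g := H) (h0 := v).
- exact: continuous_subspaceT (@cst_continuous _ _ _).
- exact: cH.
- by move=> t u bt; rewrite Hbd.
- exact: cv.
- exact: vbd.
- by move=> t; rewrite H0.
have [||||||h2 [ch2 h2bd ph2]] := homotopic_lift (phi := fun z => K' (ctr z)) (g := G2) (h0 := h1).
- exact: continuous_subspaceT (continuous_compose cctr cK').
- exact: cG2.
- by move=> t u bt; rewrite G2bd.
- exact: ch1.
- by move=> t bt; rewrite /ctr contract0 K'o h1bd.
- by move=> t; rewrite ph1 H1.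
have [||||||h3 [ch3 h3bd ph3]] := homotopic_lift (phi := Phi) (g := fun z => b (ctr z)) (h0 := h2).
- exact: cPhi.
- exact: continuous_compose cctr cb.
- by move=> t u bt; rewrite pPhi.
- exact: ch2.
- by move=> t bt; rewrite h2bd // /ctr contract1 K'Phi.
- by move=> t; rewrite ph2 G21 /ctr contract0 pe.
exists h3; split => //.
- by move=> z bz; rewrite h3bd // Phi1.
- by move=> z; rewrite ph3 /ctr contract1.
Qed.

End TrivialFibration.

(** * The bimodule structure on the boxes *)

Lemma continuous_kcontinuous (X Y : topologicalType) (f : X -> Y) :
  continuous f -> kcontinuous f.
Proof.
move=> cf; apply/continuousP => A oA.
have kA : k_open (f @^-1` A) by move=> K _; apply: open_subspaceW; move/continuousP: cf; exact.
exact: kA.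
Qed.

(** Operations of a bimodule are continuous only for the k-ified product. Composed with a map out of
    a compactly generated space they become continuous, since the image of a compact set is compact
    and a k-open set is relatively open in it. *)
Lemma space_kcontinuous (X : Defs.space) (T Y : topologicalType) (f : X -> T) (g : T -> Y) :
  continuous f -> kcontinuous g -> continuous (fun x => g (f x)).
Proof.
move=> cf /continuousP cg; apply/continuousP => A oA.
apply: space_compactly_generated => K cK.
have cfK : compact (f @` K).
  by apply: continuous_compact cK; exact: continuous_subspaceT.
have kA : k_open (g @^-1` A) := cg A oA.
have /open_subspaceP[V oV VE] := kA _ cfK.
apply/open_subspaceP; exists (f @^-1` V); first by move/continuousP: cf; exact.
apply/seteqP; split=> x [] h Kx; split=> //.
  have : ((V `&` (f @` K)) (f x)) by split => //; exists x.
  by rewrite VE => -[].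
have : ((g @^-1` A `&` (f @` K)) (f x)) by split => //; exists x.
by rewrite -VE => -[].
Qed.

Section Words.
Variable S : Type.
Implicit Types (M N : colseq S) (w : seq S).

Lemma cast_id M s w (e : w = w) (x : M w s) : cast e x = x.
Proof. by rewrite (Prop_irrelevance e erefl). Qed.

Lemma cast_map M N (f : forall w s, M w s -> N w s) w w' s (e : w = w') (x : M w s) :
  f w' s (cast e x) = cast e (f w s x).
Proof. by case: w' / e. Qed.

Lemma cast_inj M s w w' (e : w = w') (x y : M w s) : cast e x = cast e y -> x = y.
Proof. by case: w' / e. Qed.

Lemma cast_continuous M s w w' (e : w = w') : continuous (@cast S M s w w' e).
Proof. by case: w' / e; exact: continuous_id. Qed.

End Words.

Section Profiles.
Implicit Types (w l r p q : seq colour) (s a b : colour).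

Lemma profile1 a s : profile [:: a] s = (a == s).
Proof. by case: a; case: s. Qed.

Lemma profile_cons2 a b w s :
  profile (a :: b :: w) s = (a == col_c) && profile (b :: w) s.
Proof.
case: s; rewrite /profile /=; first by case: a.
by case: a.
Qed.

Lemma profile_cat l w s : w != [::] ->
  profile (l ++ w) s = all (pred1 col_c) l && profile w s.
Proof.
move=> w0; elim: l => [//|a l IHl].
case El : (l ++ w) => [|b v]; first by case: (l) (w) El w0 => [|? ?] [].
by rewrite /= El profile_cons2 -El IHl andbA.
Qed.

Lemma profile_nil s : profile [::] s = false.
Proof. by case: s. Qed.

Lemma profile_neq_nil w s : profile w s -> w != [::].
Proof. by case: w => //; rewrite profile_nil. Qed.

Lemma profile_size_gt0 w s : profile w s -> (0 < size w)%N.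
Proof. by move=> /profile_neq_nil; rewrite -size_eq0 lt0n. Qed.

Lemma profile_last l a s : profile (l ++ [:: a]) s = all (pred1 col_c) l && (a == s).
Proof. by rewrite profile_cat // profile1. Qed.

(** Used mostly backwards: a word carrying a face of value 0 shrinks to a word that still has a
    nonempty box. *)
Lemma profile_insert l a r s :
  profile (l ++ [:: col_c; a] ++ r) s = profile (l ++ a :: r) s.
Proof.
by rewrite (@profile_cat l [:: col_c, a & r]) // (@profile_cat l (a :: r)) //.
Qed.

Lemma profile_catE p q s : p != [::] -> q != [::] ->
  profile (p ++ q) s = profile p col_c && profile q s.
Proof. by move=> p0 q0; rewrite profile_cat // profile_cE p0. Qed.

End Profiles.

(** * Boxes through their lists of coordinates *)

Section BoxCoordinates.
Variable R : realType.
Local Notation I := (I01 R).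

Section Restrict.
Variable n : nat.
Implicit Types b : bool.

(** [coords] with the profile test and the dimension made variables, so that proofs can do case
    analysis on the boolean. *)
Definition rcoords b (x : Defs.restrict b (cube_space R n)) : seq I :=
  [seq (restrict_val x : cube R n) i | i <- enum 'I_n].

Lemma size_rcoords b (x : Defs.restrict b (cube_space R n)) : size (rcoords x) = n.
Proof. by rewrite size_map size_enum_ord. Qed.

Lemma rcoords_inj b : injective (@rcoords b).
Proof.
case: b => [|[]] x y /eq_in_map xy; apply: cube_eq => i.
by apply: xy; rewrite mem_enum.
Qed.

Lemma nth_rcoords (x : Defs.restrict true (cube_space R n)) (i : 'I_n) :
  nth (I0 R) (rcoords x) i = (x : cube R n) i.
Proof. by rewrite (nth_map i) ?size_enum_ord // nth_ord_enum. Qed.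

Lemma rcoords_continuous b j :
  continuous (fun x : Defs.restrict b (cube_space R n) => nth (I0 R) (rcoords x) j).
Proof.
case: b => [|[]].
have [jn|nj] := ltnP j n; last first.
  under eq_fun do rewrite nth_default ?size_rcoords //.
  exact: cst_continuous.
under eq_fun do rewrite (nth_rcoords _ (Ordinal jn)).
exact: cube_coord_continuous.
Qed.

Lemma to_restrict_continuous (T : topologicalType) b
    (f : T -> Defs.restrict b (cube_space R n)) :
  (forall j, continuous (fun x => nth (I0 R) (rcoords (f x)) j)) -> continuous f.
Proof.
case: b f => f cf; last by move=> x; case: (f x).
apply: to_cube_continuous => i; have := cf i.
by under eq_fun do rewrite nth_rcoords.
Qed.

Lemma rcoords_in b (h : b) (cs : seq I) : size cs = n ->
  rcoords (restrict_in (T := cube_space R n) h (fun i => nth (I0 R) cs i)) = cs.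
Proof.
case: b h => // h sz; rewrite /rcoords /=.
rewrite -[RHS](mkseq_nth (I0 R)) /mkseq sz -val_enum_ord -map_comp.
exact: eq_map.
Qed.

End Restrict.

Implicit Types (w l r u : seq colour) (s a : colour) (cs : seq I).

Lemma size_coords w s (x : box R w s) : size (coords x) = (size w).-1.
Proof. exact: size_rcoords. Qed.

(** Identities between boxes are checked on lists of coordinates, which forget the word and so
    absorb every [cast]. *)
Lemma coords_inj w s (x y : box R w s) : coords x = coords y -> x = y.
Proof. exact: rcoords_inj. Qed.

Lemma coords_cast w w' s (e : w = w') (x : box R w s) : coords (cast e x) = coords x.
Proof. by case: w' / e. Qed.

Definition box_of w s (h : profile w s) cs : box R w s :=
  restrict_in (T := cube_space R (size w).-1) h (fun i => nth (I0 R) cs i).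

Lemma coords_box_of w s (h : profile w s) cs :
  size cs = (size w).-1 -> coords (box_of h cs) = cs.
Proof. exact: rcoords_in. Qed.

(** A substitute for a topology on lists of length [n]; positions from [n] on give the constant
    default, so [j] can range over all numbers. *)
Definition seq_continuous (T : topologicalType) n (g : T -> seq I) : Prop :=
  (forall x, size (g x) = n) /\ forall j, continuous (fun x => nth (I0 R) (g x) j).

Lemma coords_continuous w s : seq_continuous (size w).-1 (@coords R w s).
Proof. by split=> [x|j]; [exact: size_coords|exact: rcoords_continuous]. Qed.

Lemma to_box_continuous (T : topologicalType) w s n (f : T -> box R w s) (g : T -> seq I) :
  (forall x, coords (f x) = g x) -> seq_continuous n g -> continuous f.
Proof.
move=> fg [_ cg]; apply: to_restrict_continuous => j; have := cg j.
by under eq_fun do rewrite -fg.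
Qed.

Section SeqContinuous.
Variable T : topologicalType.
Implicit Types g h : T -> seq I.

Lemma seq_continuous_comp (U : topologicalType) n (f : U -> T) g :
  continuous f -> seq_continuous n g -> seq_continuous n (fun x => g (f x)).
Proof. by move=> cf [sg cg]; split=> // j; exact: (continuous_compose cf (cg j)). Qed.

Lemma seq_continuous_cst cs : seq_continuous (size cs) (fun _ : T => cs).
Proof. by split=> // j; exact: cst_continuous. Qed.

Lemma seq_continuous_cat m n g h : seq_continuous m g -> seq_continuous n h ->
  seq_continuous (m + n) (fun x => g x ++ h x).
Proof.
move=> [sg cg] [sh ch]; split=> [x|j]; first by rewrite size_cat sg sh.
under eq_fun do rewrite nth_cat sg.
by case: (j < m)%N; [exact: cg|exact: ch].
Qed.

Lemma seq_continuous_take i n g : seq_continuous n g ->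
  seq_continuous (minn i n) (fun x => take i (g x)).
Proof.
move=> [sg cg]; split=> [x|j]; first by rewrite size_take_min sg.
have [ji|ij] := ltnP j i; first by under eq_fun do rewrite nth_take //; exact: cg.
under eq_fun do rewrite nth_default ?size_take_min ?geq_min ?ij //.
exact: cst_continuous.
Qed.

Lemma seq_continuous_drop i n g : seq_continuous n g ->
  seq_continuous (n - i) (fun x => drop i (g x)).
Proof.
move=> [sg cg]; split=> [x|j]; first by rewrite size_drop sg.
under eq_fun do rewrite nth_drop.
exact: cg.
Qed.

Lemma seq_continuous_behead n g : seq_continuous n g ->
  seq_continuous n.-1 (fun x => behead (g x)).
Proof.
move=> /(seq_continuous_drop 1)[sg cg]; split=> [x|j].
  by rewrite -drop1 sg subn1.
by have := cg j; under eq_fun do rewrite drop1.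
Qed.

End SeqContinuous.

(** The right action of the point over a word [u], with [k = (size u).-1]: it is a composite of [k]
    binary generators, each of which inserts one 0. *)
Definition insert0 i k cs : seq I := take i cs ++ nseq k (I0 R) ++ drop i cs.

Lemma insert0_cat k cs cs' : insert0 (size cs) k (cs ++ cs') = cs ++ nseq k (I0 R) ++ cs'.
Proof. by rewrite /insert0 take_size_cat // drop_size_cat. Qed.

Lemma size_insert0 i k cs : (i <= size cs)%N -> size (insert0 i k cs) = (size cs + k)%N.
Proof.
move=> ics; rewrite !size_cat size_takel // size_nseq size_drop; lia.
Qed.

(** Coordinate form of sequential associativity: zeros inserted into a block of zeros only lengthen
    it. *)
Lemma insert0_nest i j k m cs : (i <= size cs)%N ->
  insert0 (i + j) k (insert0 i (j + m) cs) = insert0 i (j + k + m) cs.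
Proof.
move=> ics; rewrite -(cat_take_drop i cs).
move: (take i cs) (drop i cs) (size_takel ics) => c1 c2 <-.
rewrite !insert0_cat !nseqD -{1}(size_nseq j (I0 R)) -size_cat -catA catA.
by rewrite insert0_cat -!catA.
Qed.

(** Coordinate form of parallel associativity: the later position shifts by [k] when the earlier
    block goes in first. *)
Lemma insert0_swap i d k m cs : (i + d <= size cs)%N ->
  insert0 (i + k + d) m (insert0 i k cs) = insert0 i k (insert0 (i + d) m cs).
Proof.
move=> idcs; have ics : (i <= size cs)%N by lia.
have dcs : (d <= size (drop i cs))%N by rewrite size_drop; lia.
rewrite -(cat_take_drop i cs).
move: (take i cs) (drop i cs) (size_takel ics) dcs => c1 c23 <- dcs.
rewrite -(cat_take_drop d c23).
move: (take d c23) (drop d c23) (size_takel dcs) => c2 c3 <-.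
rewrite insert0_cat (catA c1 c2) -size_cat insert0_cat -(catA c1 c2) insert0_cat.
rewrite -{1}(size_nseq k (I0 R)) -size_cat -size_cat [c1 ++ _ ++ _ ++ _]catA catA.
by rewrite insert0_cat -!catA.
Qed.

Lemma seq_continuous_insert0 (T : topologicalType) i k n (g : T -> seq I) :
  seq_continuous n g ->
  seq_continuous (minn i n + (k + (n - i))) (fun x => insert0 i k (g x)).
Proof.
move=> cg; apply: seq_continuous_cat; first exact: seq_continuous_take.
apply: seq_continuous_cat; last exact: seq_continuous_drop.
by have := @seq_continuous_cst T (nseq k (I0 R)); rewrite size_nseq.
Qed.

Definition box_ract : right_op (box R) act_seq := fun l a r u s x y =>
  box_of (profile_comp (restrictP x) (restrictP y)) (insert0 (size l) (size u).-1 (coords x)).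

Lemma coords_ract l a r u s (x : box R (l ++ a :: r) s) (y : act_seq u a) :
  coords (box_ract x y) = insert0 (size l) (size u).-1 (coords x).
Proof.
have u0 := profile_size_gt0 (restrictP y).
rewrite coords_box_of // size_insert0 size_coords !size_cat /=; lia.
Qed.

Definition box_to_act w s (x : box R w s) : act_seq w s := act_elt (restrictP x).

(* The concatenation of the coordinates of all the entries, each preceded by
   a [1]; without its first letter these are the coordinates of a left action. *)
Fixpoint hjoin P w : hprod (box R) P w -> seq I :=
  match P, w return hprod (box R) P w -> seq I with
  | [::], [::] => fun _ => [::]
  | p :: P', a :: w' => fun x => I1 R :: coords x.1 ++ hjoin x.2
  | [::], _ :: _ => fun _ => [::]
  | _ :: _, [::] => fun _ => [::]
  end.

Lemma hjoin_cat P1 w1 P2 w2 (x : hprod (box R) P1 w1) (y : hprod (box R) P2 w2) :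
  hjoin (hcat x y) = hjoin x ++ hjoin y.
Proof.
elim: P1 w1 x => [|p P1 IH] [|a w1] //= x.
by rewrite IH catA.
Qed.

Lemma size_hjoin P w (x : hprod (box R) P w) : size (hjoin x) = size (flatten P).
Proof.
elim: P w x => [|p P IH] [|a w] //= x.
have p0 := profile_size_gt0 (restrictP x.1).
by rewrite !size_cat size_coords IH -addSn prednK.
Qed.

(** Behind associativity of left actions: the leading 1 dropped by the inner action is put back by
    the outer one. *)
Lemma hjoin_eq P w (x : hprod (box R) P w) : w != [::] -> I1 R :: behead (hjoin x) = hjoin x.
Proof. by case: P w x => [|p P] [|a w]. Qed.

Lemma hjoin_continuous P w : seq_continuous (size (flatten P)) (@hjoin P w).
Proof.
split=> [x|]; first exact: size_hjoin.
suff [n []] : exists n, seq_continuous n (@hjoin P w) by [].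
elim: P w => [|p P IH] [|a w].
- by exists 0%N; exact: (seq_continuous_cst _ [::]).
- by exists 0%N; exact: (seq_continuous_cst _ [::]).
- by exists 0%N; exact: (seq_continuous_cst _ [::]).
have [n cn] := IH w; exists (1 + ((size p).-1 + n))%N.
apply: (@seq_continuous_cat _ 1 _ (fun=> [:: I1 R])); first exact: (seq_continuous_cst _ [:: I1 R]).
apply: seq_continuous_cat.
  apply: (@seq_continuous_comp _ _ _ fst (@coords R p a)); last exact: coords_continuous.
  exact: continuous_fst.
by apply: (@seq_continuous_comp _ _ _ snd (@hjoin P w)); first exact: continuous_snd.
Qed.

Definition box_lact w s P (x : act_seq w s) (y : hprod (box R) P w) : box R (flatten P) s :=
  box_of (profile_flatten (restrictP x) (hmap box_to_act y)) (behead (hjoin y)).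

Lemma coords_lact w s P (x : act_seq w s) (y : hprod (box R) P w) :
  coords (box_lact x y) = behead (hjoin y).
Proof. by rewrite coords_box_of // size_behead size_hjoin. Qed.

Lemma box_ract_continuous : right_op_continuous box_ract.
Proof.
move=> l a r u s; apply: continuous_kcontinuous.
apply: (to_box_continuous (fun z => coords_ract z.1 z.2)).
apply: seq_continuous_insert0; apply: seq_continuous_comp (@coords_continuous _ _).
exact: continuous_fst.
Qed.

Lemma box_lact_continuous w s P :
  kcontinuous (fun z : act_seq w s * hprod (box R) P w => box_lact z.1 z.2).
Proof.
apply: continuous_kcontinuous.
apply: (to_box_continuous (fun z => coords_lact z.1 z.2)).
apply: seq_continuous_behead; apply: seq_continuous_comp (@hjoin_continuous _ _).
exact: continuous_snd.
Qed.

Lemma box_sequential : sequential_assoc box_ract act_comp.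
Proof.
move=> l r l' r' u a b s x y z; apply: coords_inj.
have u0 := profile_size_gt0 (restrictP z).
rewrite coords_cast !coords_ract coords_cast coords_ract.
have -> : (size (l' ++ b :: r')).-1 = (size l' + size r')%N.
  by rewrite size_cat /= addnS.
have -> : (size (l' ++ u ++ r')).-1 = (size l' + (size u).-1 + size r')%N.
  by rewrite !size_cat; lia.
by rewrite size_cat insert0_nest // size_coords size_cat /=; lia.
Qed.

Lemma box_parallel : parallel_assoc box_ract.
Proof.
move=> l m r u v a b s x y z; apply: coords_inj.
have u0 := profile_size_gt0 (restrictP y).
rewrite coords_cast !coords_ract !coords_cast !coords_ract coords_cast.
have -> : size (l ++ u ++ m) = (size l + (size u).-1 + (size m).+1)%N.
  by rewrite !size_cat; lia.
have -> : size (l ++ a :: m) = (size l + (size m).+1)%N by rewrite size_cat.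
by rewrite insert0_swap // size_coords !size_cat /= size_cat /=; lia.
Qed.

Lemma box_ract_unital : right_unital box_ract (fun s => act_elt (profile_unit s)).
Proof.
move=> l a r s x; apply: coords_inj.
by rewrite coords_ract /insert0 /= cat_take_drop.
Qed.

Lemma box_lact_unital p s (y : box R p s) :
  cast (cats0 p) (box_lact (P := [:: p]) (act_elt (profile_unit s)) (y, tt)) = y.
Proof.
apply: coords_inj; rewrite coords_cast.
by apply: etrans (coords_lact (P := [:: p]) _ _) _; rewrite /= cats0.
Qed.

Lemma box_lact_assoc l a r u s (P1 P2 P3 : seq (seq colour))
    (x : act_seq (l ++ a :: r) s) (x' : act_seq u a)
    (y1 : hprod (box R) P1 l) (y2 : hprod (box R) P2 u) (y3 : hprod (box R) P3 r) :
  cast (flatten_nest P1 P2 P3) (box_lact (act_comp x x') (hcat y1 (hcat y2 y3)))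
  = box_lact x (hcat (w2 := a :: r) (P2 := flatten P2 :: P3) y1 (box_lact x' y2, y3)).
Proof.
apply: coords_inj; rewrite coords_cast !coords_lact !hjoin_cat /= coords_lact.
by rewrite -cat_cons hjoin_eq // (profile_neq_nil (restrictP x')).
Qed.

Lemma box_lact_ract l a r s (P1 P2 : seq (seq colour)) (p q v : seq colour) (b : colour)
    (x : act_seq (l ++ a :: r) s) (y1 : hprod (box R) P1 l) (y : box R (p ++ b :: q) a)
    (y2 : hprod (box R) P2 r) (z : act_seq v b) :
  box_ract (l := flatten P1 ++ p) (r := q ++ flatten P2)
    (cast (flatten_splice P1 p [:: b] q P2)
      (box_lact x (hcat (w2 := a :: r) (P2 := (p ++ b :: q) :: P2) y1 (y, y2)))) z
  = cast (flatten_splice P1 p v q P2)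
      (box_lact x (hcat (w2 := a :: r) (P2 := (p ++ v ++ q) :: P2) y1 (box_ract y z, y2))).
Proof.
apply: coords_inj; rewrite coords_ract !coords_cast !coords_lact !hjoin_cat /= coords_ract.
rewrite -(cat_take_drop (size p) (coords y)).
set c1 := take _ _; set c2 := drop _ _.
have sc : size c1 = size p by rewrite size_takel // size_coords size_cat /=; lia.
have bE t : behead (hjoin y1 ++ I1 R :: c1 ++ t) = behead (hjoin y1 ++ I1 R :: c1) ++ t.
  by case: (hjoin y1) => [|? ?] //=; rewrite -catA.
rewrite -sc insert0_cat -!catA !bE.
(* The 1 that precedes the coordinates of [y] compensates for the entry removed by [behead]. *)
have -> : size (flatten P1 ++ p) = size (behead (hjoin y1 ++ I1 R :: c1)).
  by rewrite size_behead !size_cat /= size_hjoin sc addnS.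
by rewrite insert0_cat.
Qed.

Definition box_struct : bimod_struct Act (box R).
Proof.
exact: (@BimodStruct colour Act (box R) box_ract box_lact box_ract_continuous
  box_lact_continuous box_sequential box_parallel box_ract_unital box_lact_unital
  box_lact_assoc box_lact_ract).
Defined.

End BoxCoordinates.

(** * Uniqueness of the structure *)

Section HProd.
Variables (S : Type) (M : colseq S).

(** An elimination principle, so that no tuple has to be transported along an equation splitting
    [P]. *)
Lemma hprod_catP (w1 w2 : seq S) (Q : forall P, hprod M P (w1 ++ w2) -> Prop) :
  (forall P1 P2 (y1 : hprod M P1 w1) (y2 : hprod M P2 w2), Q (P1 ++ P2) (hcat y1 y2)) ->
  forall P y, Q P y.
Proof.
elim: w1 Q => [|a w1 IH] Q hQ P y; first exact: (hQ [::] P tt y).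
case: P y => [[]|p P [y ys]].
apply: (IH (fun P ys => Q (p :: P) (y, ys))) => P1 P2 y1 y2.
exact: (hQ (p :: P1) P2 (y, y1) y2).
Qed.

Lemma hmap_hcat (N : colseq S) (f : forall w s, M w s -> N w s) P1 w1 P2 w2
    (y1 : hprod M P1 w1) (y2 : hprod M P2 w2) :
  hmap f (hcat y1 y2) = hcat (hmap f y1) (hmap f y2).
Proof.
elim: P1 w1 y1 => [|p P1 IH] [|a w1] //= [y ys].
by rewrite /= IH.
Qed.

Lemma hmap_id P w (y : hprod M P w) : hmap (fun _ _ x => x) y = y.
Proof. by elim: P w y => [|p P IH] [|a w] //= [y ys]; rewrite /= IH. Qed.

End HProd.

Lemma profile_star2 a : profile [:: col_c; a] a.
Proof. by case: a. Qed.

Definition star2 a : Act [:: col_c; a] a := act_elt (profile_star2 a).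

(** * Reduction of all operations to the binary generators *)

Section Generators.
Variables (M N : bimodule Act) (f : forall w s, M w s -> N w s).
Hypothesis f_ract : forall l a r s (x : M (l ++ a :: r) s),
  f (ract M x (star2 a)) = ract N (f x) (star2 a).
Hypothesis f_lact : forall p q s (x : M p col_c) (y : M q s),
  f (lact M (P := [:: p; q]) (star2 s) (x, (y, tt)))
  = lact N (P := [:: p; q]) (star2 s) (f x, (f y, tt)).

Let good_ract u a (y : Act u a) := forall l r s (x : M (l ++ a :: r) s),
  f (ract M x y) = ract N (f x) y.

Let good_lact w s (x : Act w s) := forall P (y : hprod M P w),
  f (lact M x y) = lact N x (hmap f y).

Lemma good_ract_comp l a r u s (y : Act (l ++ a :: r) s) (z : Act u a) :
  good_ract y -> good_ract z -> good_ract (op_comp y z).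
Proof.
move=> gy gz l' r' s' x.
apply: (@cast_inj _ _ _ _ _ (splice_nest l' l u r r')).
by rewrite -cast_map -!ract_sequential gz -gy cast_map.
Qed.

Lemma good_lact_comp l a r u s (y : Act (l ++ a :: r) s) (z : Act u a) :
  good_lact y -> good_lact z -> good_lact (op_comp y z).
Proof.
move=> gy gz; apply: hprod_catP => P1 P23 y1; move: P23.
apply: hprod_catP => P2 P3 y2 y3.
apply: (@cast_inj _ _ _ _ _ (flatten_nest P1 P2 P3)).
by rewrite -cast_map !hmap_hcat !lact_assoc gy hmap_hcat /= gz.
Qed.

(** A word with at least two inputs starts with [col_c], and its operation is [star2 s] with the
    operation of the tail grafted into the second input. Which composite is taken is immaterial, as
    components of [Act] have at most one point. *)
Lemma act_generators_ind (Q : forall w s, Act w s -> Prop) :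
  (forall s, Q _ _ (op_unit Act s)) -> (forall s, Q _ _ (star2 s)) ->
  (forall l a r u s (y : Act (l ++ a :: r) s) (z : Act u a),
    Q _ _ y -> Q _ _ z -> Q _ _ (op_comp y z)) ->
  forall w s (x : Act w s), Q w s x.
Proof.
move=> Q1 Q2 Qc; elim=> [|a [|b w] IH] s x.
- by have := restrictP x; rewrite profile_nil.
- have := restrictP x; rewrite profile1 => /eqP ea; move: x; rewrite ea => x.
  by rewrite (act_elt_uniq x (op_unit Act s)).
have := restrictP x; rewrite profile_cons2 => /andP[/eqP ea pw].
move: x; rewrite ea => x.
have transfer v v' (e : v = v') (y : Act v s) : Q v s y -> forall x' : Act v' s, Q v' s x'.
  by case: v' / e => Qy x'; rewrite (act_elt_uniq x' y).
apply: (transfer _ _ _ _ (Qc [:: col_c] s [::] (b :: w) s (star2 s) (act_elt pw) (Q2 s) (IH s _))).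
by rewrite cats0.
Qed.

Lemma generators_ract l a r u s (x : M (l ++ a :: r) s) (y : Act u a) :
  f (ract M x y) = ract N (f x) y.
Proof.
suff : good_ract y by exact.
move: u a y {l r s x}; apply: act_generators_ind.
- by move=> s l r s' x; rewrite !ract_unital.
- by move=> s l r s' x; exact: f_ract.
- exact: good_ract_comp.
Qed.

Lemma generators_lact w s P (x : Act w s) (y : hprod M P w) :
  f (lact M x y) = lact N x (hmap f y).
Proof.
suff : good_lact x by exact.
move: w s x {P y}; apply: act_generators_ind.
- move=> s [|p [|q P]] //= [y []] //.
  apply: (@cast_inj _ _ _ _ _ (cats0 p)); rewrite -cast_map.
  by rewrite !lact_unital.
- move=> s [|p [|q [|p' P]]] //=; first by case=> ? [].
    by case=> y [z []]; exact: f_lact.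
  by case=> ? [? []].
- exact: good_lact_comp.
Qed.

End Generators.

(** The axioms are propositions, so proof irrelevance leaves only the two operations to compare. *)
Lemma bimod_struct_eq (S : Type) (O : operad S) (M : colseq S) (B B' : bimod_struct O M) :
  (forall l a r u s (x : M (l ++ a :: r) s) (y : O u a), ract B x y = ract B' x y) ->
  (forall w s P (x : O w s) (y : hprod M P w), lact B x y = lact B' x y) ->
  B = B'.
Proof.
case: B => r l c1 c2 c3 c4 c5 c6 c7 c8; case: B' => r' l' c1' c2' c3' c4' c5' c6' c7' c8' /=.
move=> er el.
have Er : r = r'.
  by do 5 (apply: functional_extensionality_dep => ?); do 2 (apply: funext => ?); exact: er.
have El : l = l'.
  by do 3 (apply: functional_extensionality_dep => ?); do 2 (apply: funext => ?); exact: el.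
by subst; congr BimodStruct; exact: Prop_irrelevance.
Qed.

Section BoxUniqueness.
Variable R : realType.
Local Notation I := (I01 R).

Lemma star2cE : star2c = star2 col_c. Proof. exact: act_elt_uniq. Qed.
Lemma star2oE : star2o = star2 col_o. Proof. exact: act_elt_uniq. Qed.

Lemma all_col_c w : all (pred1 col_c) w -> exists n, w = nseq n col_c.
Proof. by move=> /all_pred1P ->; exists (size w). Qed.

Lemma profile_c_nseq w : profile w col_c -> exists n, w = nseq n col_c.
Proof. by rewrite profile_cE => /andP[_]; exact: all_col_c. Qed.

Lemma profile_o_rcons w : profile w col_o -> exists n, w = rcons (nseq n col_c) col_o.
Proof. by move=> /profile_oP[v /all_col_c[n ->] ->]; exists n. Qed.

Lemma insert0_last i (cs : seq I) : size cs = i -> insert0 i 1 cs = rcons cs (I0 R).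
Proof. by move=> si; rewrite /insert0 take_oversize ?drop_oversize ?si // cats1. Qed.

Section OperationsFormulas.
Variable B : bimod_struct Act (box R).
Hypothesis hB : box_operations B.

Lemma box_operations_ract l a r s (x : box R (l ++ a :: r) s) :
  coords (ract B x (star2 a)) = insert0 (size l) 1 (coords x).
Proof.
case: hB => hcc hoc hoo _ _; have := restrictP x.
case: r x => [|b r] x.
  rewrite profile_last => /andP[/all_col_c[n En] /eqP Ea]; subst l s.
  case: a x => x.
    rewrite -star2oE hoo insert0_last //.
    by rewrite size_coords size_cat /= addn1.
  by rewrite -star2cE (hcc n 0%N) /insert0 size_nseq.
rewrite profile_cat // profile_cons2 => /and3P[/all_col_c[n En] /eqP Ea].
subst l a; case: s x => x.
  case/profile_o_rcons=> m Em; move: x; rewrite Em => x.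
  by rewrite -star2cE hoc /insert0 size_nseq.
case/profile_c_nseq=> m Em; move: x; rewrite Em => x.
by rewrite -star2cE hcc /insert0 size_nseq.
Qed.

Lemma box_operations_lact p q s (x : box R p col_c) (y : box R q s) :
  coords (lact B (P := [:: p; q]) (star2 s) (x, (y, tt))) = coords x ++ I1 R :: coords y.
Proof.
case: hB => _ _ _ hc ho; have /profile_c_nseq[n En] := restrictP x; subst p.
have := restrictP y; case: s y => y.
  by case/profile_o_rcons=> m Em; subst q; rewrite -star2oE ho.
by case/profile_c_nseq=> m Em; subst q; rewrite -star2cE hc.
Qed.

End OperationsFormulas.

Lemma box_struct_ract l a r s (x : box R (l ++ a :: r) s) :
  coords (ract (box_struct R) x (star2 a)) = insert0 (size l) 1 (coords x).
Proof. exact: coords_ract. Qed.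

Lemma box_struct_lact p q s (x : box R p col_c) (y : box R q s) :
  coords (lact (box_struct R) (P := [:: p; q]) (star2 s) (x, (y, tt)))
  = coords x ++ I1 R :: coords y.
Proof. by apply: etrans (coords_lact (P := [:: p; q]) _ _) _; rewrite /= cats0. Qed.

Lemma box_struct_operations : box_operations (box_struct R).
Proof.
split.
- by move=> p q x; rewrite star2cE box_struct_ract /insert0 size_nseq.
- by move=> p q x; rewrite star2cE box_struct_ract /insert0 size_nseq.
- move=> p x; rewrite star2oE box_struct_ract insert0_last //.
  by rewrite size_coords size_cat /= addn1.
- by move=> n m x y; rewrite star2cE box_struct_lact.
- by move=> n m x y; rewrite star2oE box_struct_lact.
Qed.

Lemma box_struct_unique : unique (@box_operations R) (box_struct R).
Proof.
split; first exact: box_struct_operations.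
move=> B hB.
(* The identity, viewed as a map from one structure to the other, respects the generators and hence
   all operations. *)
pose f w s (x : box R w s) := x.
have fr l a r s (x : Bimodule (box_struct R) (l ++ a :: r) s) :
    f _ _ (ract (Bimodule (box_struct R)) x (star2 a)) = ract (Bimodule B) (f _ _ x) (star2 a).
  by apply: coords_inj; rewrite box_struct_ract box_operations_ract.
have fl p q s (x : Bimodule (box_struct R) p col_c) (y : Bimodule (box_struct R) q s) :
    f _ _ (lact (Bimodule (box_struct R)) (P := [:: p; q]) (star2 s) (x, (y, tt)))
    = lact (Bimodule B) (P := [:: p; q]) (star2 s) (f _ _ x, (f _ _ y, tt)).
  apply: coords_inj; apply: etrans (box_struct_lact x y) _.
  by rewrite /f box_operations_lact.
apply: bimod_struct_eq => [l a r u s x y|w s P x y].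
  exact: (generators_ract (N := Bimodule B) fr).
by have := generators_lact (N := Bimodule B) fl x y; rewrite hmap_id.
Qed.

End BoxUniqueness.

(** * Lifting against trivial fibrations of bimodules *)

Section HEq.
Variables (S : Type) (M : colseq S).

(* Equality across provably equal words, so that the casts in the bimodule
   axioms need not be tracked. *)
Definition heq s w w' (x : M w s) (y : M w' s) : Prop := exists e : w = w', cast e x = y.

Lemma heq_refl s w (x : M w s) : heq x x.
Proof. by exists erefl. Qed.

Lemma heq_cast s w w' (e : w = w') (x : M w s) : heq (cast e x) x.
Proof. by case: w' / e; exact: heq_refl. Qed.

Lemma heq_sym s w w' (x : M w s) (y : M w' s) : heq x y -> heq y x.
Proof. by case=> e <-; exact: heq_cast. Qed.

Lemma heq_trans s w w' w'' (x : M w s) (y : M w' s) (z : M w'' s) :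
  heq x y -> heq y z -> heq x z.
Proof. by case=> e <- [e' <-]; case: _ / e'; exists e. Qed.

Lemma heq_eq s w (x y : M w s) : heq x y -> x = y.
Proof. by case=> e <-; rewrite cast_id. Qed.

Lemma eq_heq s w (x y : M w s) : x = y -> heq x y.
Proof. by move=> ->; exact: heq_refl. Qed.

Lemma heq_map (N : colseq S) (f : forall w s, M w s -> N w s) s w w' (x : M w s) (y : M w' s) :
  heq x y -> exists e : w = w', cast e (f w s x) = f w' s y.
Proof. by case=> e <-; exists e; rewrite cast_map. Qed.

End HEq.

(** * The bimodule axioms as relations between faces *)

Section HEqOperations.
Variable M : bimodule Act.
Implicit Types (l r m p q : seq colour) (a b s : colour).

Definition face0 l a r s (x : M (l ++ a :: r) s) : M (l ++ [:: col_c; a] ++ r) s :=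
  ract M x (star2 a).

Definition face1 p q s (x : M p col_c) (y : M q s) : M (flatten [:: p; q]) s :=
  lact M (P := [:: p; q]) (star2 s) (x, (y, tt)).

Lemma ract_heq l l' a r r' u s (x : M (l ++ a :: r) s) (x' : M (l' ++ a :: r') s) (y y' : Act u a) :
  l = l' -> r = r' -> heq x x' -> heq (ract M x y) (ract M x' y').
Proof.
move=> el er; subst l' r'; move=> xx; rewrite (heq_eq xx) (act_elt_uniq y y').
exact: heq_refl.
Qed.

Lemma face0_heq l l' a a' r r' s (x : M (l ++ a :: r) s) (x' : M (l' ++ a' :: r') s) :
  l = l' -> a = a' -> r = r' -> heq x x' -> heq (face0 x) (face0 x').
Proof. by move=> el ea er; subst a'; exact: ract_heq. Qed.

Lemma face1_heq p p' q q' s (x : M p col_c) (x' : M p' col_c) (y : M q s) (y' : M q' s) :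
  heq x x' -> heq y y' -> heq (face1 x y) (face1 x' y').
Proof. by case=> e <- [e' <-]; case: _ / e; case: _ / e'; exact: heq_refl. Qed.

(** Both sides are the action on [z] of one ternary operation, written as [star2 a] with a generator
    grafted into its second or its first input. The extra element [y] stands for [face0 z] over a
    reassociated word; the following lemmas have such elements for the same reason. *)
Lemma face0_face0_near l a r s (z : M (l ++ a :: r) s) (y : M ((l ++ [:: col_c]) ++ a :: r) s) :
  heq y (face0 z) ->
  heq (face0 y) (face0 (l := l) (a := col_c) (r := a :: r) (face0 z)).
Proof.
move=> yz.
have E1 := ract_sequential M (l' := [:: col_c]) (r' := [::]) z (star2 a) (star2 a).
have E2 := ract_sequential M (l' := [::]) (r' := [:: a]) z (star2 a) (star2 col_c).
have H1 : heq (face0 y) (ract M z (op_comp (l := [:: col_c]) (r := [::]) (star2 a) (star2 a))).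
  apply: heq_trans (heq_cast (splice_nest l [:: col_c] [:: col_c; a] [::] r) _).
  rewrite -E1; apply: face0_heq => //.
  by apply: heq_trans yz _; exact/heq_sym/heq_cast.
apply: heq_trans H1 _.
rewrite (act_elt_uniq (op_comp (l := [:: col_c]) (r := [::]) (star2 a) (star2 a))
  (op_comp (l := [::]) (r := [:: a]) (star2 a) (star2 col_c))).
apply: heq_sym.
apply: heq_trans (heq_cast (splice_nest l [::] [:: col_c; col_c] [:: a] r) _).
rewrite -E2; apply: (face0_heq (l' := l ++ [::])) => //; first by rewrite cats0.
exact/heq_sym/heq_cast.
Qed.

Lemma face0_face0_far l a m b r s (z : M (l ++ a :: m ++ b :: r) s)
    (z' : M ((l ++ a :: m) ++ b :: r) s)
    (y : M ((l ++ [:: col_c; a] ++ m) ++ b :: r) s)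
    (y' : M (l ++ a :: (m ++ [:: col_c; b] ++ r)) s) :
  heq z' z -> heq y (face0 z) -> heq y' (face0 z') -> heq (face0 y) (face0 y').
Proof.
move=> zz' yz yz'.
have E := ract_parallel M z (star2 a) (star2 b).
apply: heq_trans (_ : heq _ (face0 (l := l ++ [:: col_c; a] ++ m)
   (cast (splice_right l [:: col_c; a] m (b :: r)) (face0 z)))) _.
  by apply: face0_heq => //; apply: heq_trans yz _; exact/heq_sym/heq_cast.
apply: heq_trans (eq_heq E) _; apply: heq_trans (heq_cast _ _) _; apply: face0_heq => //.
apply: heq_trans (heq_cast _ _) _; apply: heq_trans (heq_sym yz').
apply: face0_heq => //; apply: heq_trans (heq_cast _ _) _; exact: heq_sym.
Qed.

Lemma face0_face1_left l a r q s (x : M (l ++ a :: r) col_c) (y : M q s)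
    (t : M (l ++ a :: (r ++ q)) s) :
  heq t (face1 x y) -> heq (face0 t) (face1 (face0 x) y).
Proof.
move=> txy.
have E := lact_ract M (l := [::]) (r := [:: s]) (P1 := [::]) (P2 := [:: q])
  (star2 s) tt x (y, tt) (star2 a).
apply: heq_trans (_ : heq _ (cast (flatten_splice [::] l [:: col_c; a] r [:: q]) (face1 (face0 x) y))) _.
  apply: heq_trans (eq_heq E); apply: face0_heq; rewrite /= ?cats0 //.
  by apply: heq_trans txy _; exact/heq_sym/heq_cast.
exact: heq_cast.
Qed.

Lemma face0_face1_right p l a r s (x : M p col_c) (y : M (l ++ a :: r) s)
    (t : M ((p ++ l) ++ a :: r) s) :
  heq t (face1 x y) -> heq (face0 t) (face1 x (face0 y)).
Proof.
move=> txy.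
have E := lact_ract M (l := [:: col_c]) (r := [::]) (P1 := [:: p]) (P2 := [::])
  (star2 s) (x, tt) y tt (star2 a).
apply: heq_trans (_ : heq _ (cast (flatten_splice [:: p] l [:: col_c; a] r [::]) (face1 x (face0 y)))) _.
  apply: heq_trans (eq_heq E); apply: face0_heq; rewrite /= ?cats0 //.
  by apply: heq_trans txy _; exact/heq_sym/heq_cast.
exact: heq_cast.
Qed.

(** Both sides are the left action of the same ternary operation on [(x, y, z)], decomposed in two
    ways. *)
Lemma face1_face1 p q r pq qr s (x : M p col_c) (y : M q col_c) (z : M r s)
    (xy : M pq col_c) (yz : M qr s) :
  heq xy (face1 x y) -> heq yz (face1 y z) -> heq (face1 xy z) (face1 x yz).
Proof.
move=> hxy hyz.
have E1 := lact_assoc M (l := [::]) (r := [:: s]) (P1 := [::]) (P2 := [:: p; q]) (P3 := [:: r])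
  (star2 s) (star2 col_c) tt (x, (y, tt)) (z, tt).
have E2 := lact_assoc M (l := [:: col_c]) (r := [::]) (P1 := [:: p]) (P2 := [:: q; r]) (P3 := [::])
  (star2 s) (star2 s) (x, tt) (y, (z, tt)) tt.
apply: heq_trans (face1_heq hxy (heq_refl z)) _.
apply: heq_trans (face1_heq (heq_refl x) (heq_sym hyz)).
apply: heq_trans (eq_heq (esym E1)) _; apply: heq_trans (eq_heq E2).
apply: heq_trans (heq_cast _ _) _; apply: heq_trans (heq_sym (heq_cast _ _)).
apply: eq_heq; exact: (congr1 (fun o : Act [:: col_c; col_c; s] s =>
  lact M (P := [:: p; q; r]) o (x, (y, (z, tt)))) (act_elt_uniq _ _)).
Qed.

End HEqOperations.

Lemma cat_compare (T : Type) (p q p' q' : seq T) :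
  p ++ q = p' ++ q' -> (size p <= size p')%N -> exists m, p' = p ++ m /\ q = m ++ q'.
Proof.
elim: p p' => [|a p IH] [|a' p'] //=; first by exists [::].
  by exists (a' :: p').
by move=> [-> /IH{}IH] /IH[m [-> ->]]; exists m.
Qed.

Lemma within_bigsetU (T U : topologicalType) (J : eqType) (r : seq J) (A : J -> set T) (f : T -> U) :
  (forall i, closed (A i)) -> (forall i, i \in r -> {within A i, continuous f}) ->
  {within \big[setU/set0]_(i <- r) A i, continuous f}.
Proof.
move=> cA; elim: r => [|i r IH] cf; first by rewrite big_nil; exact: continuous_subspace0.
rewrite big_cons; apply: withinU_continuous => //.
- by apply: closed_bigsetU.
- by apply: cf; rewrite mem_head.
- by apply: IH => k kr; apply: cf; rewrite inE kr orbT.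
Qed.

(** * The boundary of a box as a finite union of closed faces *)

Section BoxBoundary.
Variable R : realType.
Local Notation I := (I01 R).
Local Notation B := (Bimodule (box_struct R)).
Implicit Types (w l r u v : seq colour) (a s : colour) (cs : seq I).

Lemma box_heq w w' s (x : B w s) (y : B w' s) :
  w = w' -> coords x = coords y -> heq x y.
Proof. by move=> ew; subst w'; move=> /coords_inj ->; exact: heq_refl. Qed.

Lemma heq_coords w w' s (x : B w s) (y : B w' s) : heq x y -> coords x = coords y.
Proof. by case=> e <-; rewrite coords_cast. Qed.

Lemma coords_face0 l a r s (x : B (l ++ a :: r) s) :
  coords (face0 x) = insert0 (size l) 1 (coords x).
Proof. exact: box_struct_ract. Qed.

Lemma coords_face1 p q s (x : B p col_c) (y : B q s) :
  coords (face1 x y) = coords x ++ I1 R :: coords y.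
Proof. exact: box_struct_lact. Qed.

Lemma insert01_cat cs cs' : insert0 (size cs) 1 (cs ++ cs') = cs ++ I0 R :: cs'.
Proof. exact: insert0_cat. Qed.

Lemma coords_split l a r s (x : B (l ++ a :: r) s) :
  exists c1 c2, [/\ coords x = c1 ++ c2, size c1 = size l & size c2 = size r].
Proof.
exists (take (size l) (coords x)), (drop (size l) (coords x)).
have sx : size (coords x) = (size l + size r)%N by rewrite size_coords size_cat /= addnS.
by rewrite cat_take_drop size_drop size_takel sx ?leq_addr // addKn.
Qed.

Definition box_boundary w s : set (box R w s) :=
  [set t | I0 R \in coords t \/ I1 R \in coords t].

Lemma restrict_trivial_lift (E X : topologicalType) (p : E -> X) b n :
  serre_fibration R p -> weak_homotopy_equivalence R p ->
  lifts_from [set t : Defs.restrict b (cube_space R n) |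
    I0 R \in rcoords t \/ I1 R \in rcoords t] p.
Proof.
move=> pS pW; case: b => [|f h _ _ _]; last first.
  by exists f; split; case.
have -> : [set t : Defs.restrict true (cube_space R n) | I0 R \in rcoords t \/ I1 R \in rcoords t]
    = @cube_boundary R n.
  apply/seteqP; split=> t /=.
    by case=> /mapP[i _ ti]; exists i; [left|right].
  by case=> i [] ti; [left|right]; apply/mapP; exists i; rewrite ?mem_enum.
exact: trivial_fibration_lift.
Qed.

Lemma box_trivial_lift (E X : topologicalType) (p : E -> X) w s :
  serre_fibration R p -> weak_homotopy_equivalence R p -> lifts_from (@box_boundary w s) p.
Proof. exact: restrict_trivial_lift. Qed.

(** The bound on [i] excludes positions where [nth] returns its default [I0]. *)
Definition box_face w s (i : nat) (e : I) : set (box R w s) :=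
  [set t | (i < (size w).-1)%N /\ nth (I0 R) (coords t) i = e].

Lemma closed_box_face w s i e : closed (@box_face w s i e).
Proof.
have [iw|wi] := ltnP i (size w).-1; last first.
  by rewrite (_ : box_face _ _ = set0); [exact: closed0|apply/seteqP; split=> t [] //; rewrite ltnNge wi].
rewrite (_ : box_face _ _ = (fun t : box R w s => nth (I0 R) (coords t) i) @^-1` [set e]).
  apply: preimage_closed; last exact: closed_I01_set1.
  by move=> t _; exact: (coords_continuous R w s).2.
by apply/seteqP; split=> t //= [].
Qed.

Lemma box_boundaryE w s : @box_boundary w s =
  \big[setU/set0]_(i <- iota 0 (size w).-1) (box_face i (I0 R) `|` box_face i (I1 R)).
Proof.
rewrite -bigcup_seq; apply/seteqP; split=> t.
  have memP e : e \in coords t -> exists2 i, i \in iota 0 (size w).-1 & box_face i e t.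
    move=> te; have := te; rewrite -index_mem size_coords => it.
    by exists (index e (coords t)); [rewrite mem_iota|split=> //; rewrite nth_index].
  by case=> /memP[i iw it]; exists i => //; [left|right].
by case=> i _ [] [iw ti]; [left|right]; rewrite -[X in X \in _]ti mem_nth ?size_coords.
Qed.

End BoxBoundary.

Section Lifting.
Variable R : realType.
Local Notation I := (I01 R).
Local Notation B := (Bimodule (box_struct R)).
Variables (E X : bimodule Act) (p : bimod_map E X) (g : bimod_map B X).
Hypothesis pF : bimod_fibration R p.
Hypothesis pW : bimod_weak_equivalence R p.
Implicit Types (w l r u v : seq colour) (a s : colour).

Definition box_family := forall w s, B w s -> E w s.
Implicit Types h : box_family.

(** The bounds concern the word of the result: [face0] adds one input, hence the strict inequality.
    On words longer than [n] nothing is asked of [h]. *)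
Record partial_lift (n : nat) (h : box_family) : Prop := PartialLift {
  pl_continuous : forall w s, (size w <= n)%N -> continuous (h w s);
  pl_lift : forall w s x, (size w <= n)%N -> p w s (h w s x) = g w s x;
  pl_face0 : forall l a r s (x : B (l ++ a :: r) s), (size (l ++ a :: r) < n)%N ->
    h _ _ (face0 x) = face0 (h _ _ x);
  pl_face1 : forall u v s (x : B u col_c) (y : B v s), (size (u ++ v) <= n)%N ->
    h _ _ (face1 x y) = face1 (h _ _ x) (h _ _ y) }.

Lemma box_family_heq h w w' s (x : B w s) (y : B w' s) : heq x y -> heq (h _ _ x) (h _ _ y).
Proof. by move/(heq_map h). Qed.

Lemma box_neq_nil w s (x : B w s) : w != [::].
Proof. exact: profile_neq_nil (restrictP x). Qed.

Lemma box_size_gt0 w s (x : B w s) : (0 < size w)%N.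
Proof. exact: profile_size_gt0 (restrictP x). Qed.

(** * The inductive step: prescribed values on the boundary of a box *)

Section Step.
Variables (n : nat) (h : box_family).
Hypothesis hn : partial_lift n h.

(** Let [m] be the part of [l'] beyond [l]. If it is empty, the two faces coincide. Otherwise [x]
    and [x'] are faces of a common [z] with two inputs fewer than [t], and [hn] reduces the claim to
    [face0_face0_near] when [m] has one letter and to [face0_face0_far] when it is longer. *)
Lemma face0_face0_agree w s (t : B w s) l a r (x : B (l ++ a :: r) s)
    l' a' r' (x' : B (l' ++ a' :: r') s) :
  size w = n.+1 -> heq t (face0 x) -> heq t (face0 x') -> (size l <= size l')%N ->
  heq (face0 (h x)) (face0 (h x')).
Proof.
move=> sw tx tx' ll'.
have [e1 _] := tx; have xx' := heq_trans (heq_sym tx) tx'.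
have sn : size (l ++ [:: col_c; a] ++ r) = n.+1 by rewrite -sw e1.
have := heq_coords xx'; rewrite !coords_face0.
have [e _] := xx'; have [m [el' em]] := cat_compare e ll'; subst l'.
have [c1 [c2 [cx sc1 sc2]]] := coords_split x.
have [c1' [c2' [cx' sc1' sc2']]] := coords_split x'.
rewrite cx cx' -sc1 -sc1' !insert01_cat => ecs.
have c1c1' : (size c1 <= size c1')%N by rewrite sc1 sc1'.
have [k [ek ek2]] := cat_compare ecs c1c1'; subst c1'.
have sk : size k = size m by move: sc1'; rewrite !size_cat; lia.
case: m em x' cx' xx' tx' sk sc1' ecs e c1c1' ll' => [|d m] /= em x' cx' xx' tx' sk sc1' ecs e c1c1' ll'.
  move/size0nil: sk => k0; subst k.
  case: em => ea er; subst a' r'; case: ek2 => ec2; subst c2'.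
  apply: face0_heq; rewrite ?cats0 //; apply: box_family_heq.
  by apply: box_heq; rewrite ?cats0 // cx cx' cats0.
case: k sk ek2 cx' sc1' ecs c1c1' => [//|k0 k] /= [sk] [ek0 ec2] cx' sc1' ecs c1c1'.
subst k0 c2; case: em => ed em; subst d.
case: m em sk x' cx' xx' tx' sc1' e ll' => [|d m] /= em sk x' cx' xx' tx' sc1' e ll'.
  move/size0nil: sk => k0; subst k; case: em => ea er; subst a r.
  have pz : profile (l ++ a' :: r') s by rewrite -profile_insert; exact: restrictP x.
  pose z : B (l ++ a' :: r') s := box_of pz (c1 ++ c2').
  have cz : coords z = c1 ++ c2'.
    by rewrite coords_box_of // !size_cat /= sc1 sc2' addnS.
  have xz : heq x (face0 z).
    by apply: box_heq => //; rewrite coords_face0 cz -sc1 insert01_cat cx.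
  have xz' : heq x' (face0 z).
    apply: box_heq; first by rewrite -catA.
    by rewrite coords_face0 cz -sc1 insert01_cat cx' -catA.
  have sz : (size (l ++ a' :: r') < n)%N.
    by move: sn; rewrite !size_cat /=; lia.
  have hz := pl_face0 hn z sz.
  apply: heq_sym; apply: heq_trans (face0_face0_near (z := h z) _) _.
    by rewrite -hz; exact: box_family_heq.
  apply: face0_heq => //; rewrite -hz; apply: box_family_heq; exact: heq_sym.
case: em => ed er; subst d r.
have pz : profile (l ++ a :: m ++ a' :: r') s.
  have := restrictP x; rewrite -cat_cons catA profile_insert.
  by rewrite -catA.
pose z : B (l ++ a :: m ++ a' :: r') s := box_of pz (c1 ++ k ++ c2').
have cz : coords z = c1 ++ k ++ c2'.
  by rewrite coords_box_of // !size_cat /= size_cat sc1 sk sc2' /=; lia.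
have ez : l ++ a :: m ++ a' :: r' = (l ++ a :: m) ++ a' :: r' by rewrite -catA.
pose z' : B ((l ++ a :: m) ++ a' :: r') s := cast ez z.
have xz : heq x (face0 z').
  apply: box_heq; first by rewrite -catA.
  rewrite coords_face0 coords_cast cz catA.
  have -> : size (l ++ a :: m) = size (c1 ++ k) by rewrite !size_cat /= sc1 sk.
  by rewrite insert01_cat cx -!catA.
have xz' : heq x' (face0 z).
  apply: box_heq; first by rewrite -!catA.
  by rewrite coords_face0 cz -sc1 insert01_cat cx' -catA.
have sz : (size (l ++ a :: m ++ a' :: r') < n)%N.
  by move: sn; rewrite !size_cat /= ?size_cat /=; lia.
have hz := pl_face0 hn z sz.
have sz' : (size ((l ++ a :: m) ++ a' :: r') < n)%N by rewrite -ez.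
have hz' := pl_face0 hn z' sz'.
apply: heq_sym; apply: (face0_face0_far (M := E) (z := h z) (z' := h z') (y := h x') (y' := h x)).
- by apply: box_family_heq; exact: heq_cast.
- by rewrite -hz; exact: box_family_heq.
- by rewrite -hz'; exact: box_family_heq.
Qed.

(** The 0 and the 1 cannot occupy the same position, so the 0 lies in [y] or in [z]. Removing it
    there exhibits that factor as a [face0] and [x] as a [face1], and [lact_ract] in [E] compares
    the two orders. *)
Lemma face0_face1_agree w s (t : B w s) l a r (x : B (l ++ a :: r) s)
    u v (y : B u col_c) (z : B v s) :
  size w = n.+1 -> heq t (face0 x) -> heq t (face1 y z) ->
  heq (face0 (h x)) (face1 (h y) (h z)).
Proof.
move=> sw tx tyz; have [e1 _] := tx.
have sn : size (l ++ [:: col_c; a] ++ r) = n.+1 by rewrite -sw e1.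
have xyz := heq_trans (heq_sym tx) tyz; have := heq_coords xyz.
rewrite coords_face0 coords_face1.
have [c1 [c2 [cx sc1 sc2]]] := coords_split x.
have [e _] := xyz; rewrite /= cats0 in e.
have u0 := box_size_gt0 y; have v0 := box_size_gt0 z.
have sy := size_coords y; have sz := size_coords z.
rewrite cx -sc1 insert01_cat => ecs.
have [c1y|yc1] := leqP (size c1) (size (coords y)).
  have [[|k0 k] [ek ek2]] := cat_compare ecs c1y.
    by case: (@I0_neq_I1 R (congr1 (head (I0 R)) ek2)).
  case: ek2 => ek0 ec2; subst k0 c2.
  have sk : size (coords y) = (size l + (size k).+1)%N by rewrite ek size_cat /= sc1.
  have lu : (size (l ++ [:: col_c; a]) <= size u)%N by rewrite size_cat /=; lia.
  have e' : (l ++ [:: col_c; a]) ++ r = u ++ v by rewrite -catA.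
  have [m [eu er]] := cat_compare e' lu.
  subst u r; have sm : size m = size k by move: sy; rewrite sk !size_cat /=; lia.
  have py : profile (l ++ a :: m) col_c by rewrite -profile_insert catA; exact: restrictP y.
  pose y0 : B (l ++ a :: m) col_c := box_of py (c1 ++ k).
  have cy0 : coords y0 = c1 ++ k.
    by rewrite coords_box_of // !size_cat /= sc1 sm addnS.
  have yy0 : heq y (face0 y0).
    apply: box_heq; first by rewrite -catA.
    by rewrite coords_face0 cy0 -sc1 insert01_cat.
  have xy0 : heq x (face1 y0 z).
    apply: box_heq; first by rewrite /= cats0 -catA.
    by rewrite coords_face1 cy0 cx -catA.
  have sw' : (size (l ++ a :: m) + size v = n)%N.
    by move: sn; rewrite !size_cat /= ?size_cat /=; lia.
  apply: heq_trans (face0_face1_left (x := h y0) (y := h z) _) _.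
    rewrite -(pl_face1 hn); first exact: box_family_heq.
    by rewrite size_cat sw'.
  apply: face1_heq; last exact: heq_refl.
  rewrite -(pl_face0 hn); last by lia.
  by apply: box_family_heq; exact: heq_sym.
have [[|k0 k] [ek ek2]] := cat_compare (esym ecs) (ltnW yc1).
  by case: (@I0_neq_I1 R (congr1 (head (I0 R)) (esym ek2))).
case: ek2 => ek0 ez; subst k0 c1.
have sk : size l = (size u + size k)%N by rewrite -sc1 size_cat /= sy -addSnnS prednK.
have ul : (size u <= size l)%N by rewrite sk leq_addr.
have [m [el ev]] := cat_compare (esym e) ul.
subst l v; have sm : size m = size k by move: sk; rewrite size_cat; lia.
have pz : profile (m ++ a :: r) s by rewrite -profile_insert; exact: restrictP z.
pose z0 : B (m ++ a :: r) s := box_of pz (k ++ c2).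
have cz0 : coords z0 = k ++ c2.
  by rewrite coords_box_of // !size_cat /= sc2 sm addnS.
have zz0 : heq z (face0 z0).
  by apply: box_heq => //; rewrite coords_face0 cz0 sm insert01_cat.
have xz0 : heq x (face1 y z0).
  apply: box_heq; first by rewrite /= cats0 -catA.
  by rewrite coords_face1 cz0 cx -catA.
have sw' : (size u + size (m ++ a :: r) = n)%N.
  by move: sn; rewrite !size_cat /=; lia.
apply: heq_trans (face0_face1_right (x := h y) (y := h z0) _) _.
  rewrite -(pl_face1 hn); first exact: box_family_heq.
  by rewrite size_cat sw'.
apply: face1_heq; first exact: heq_refl.
rewrite -(pl_face0 hn); last by lia.
by apply: box_family_heq; exact: heq_sym.
Qed.

(** Two distinct cuts leave a middle piece [z], with [x'] composed of [x] and [z], and [y] composed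
    of [z] and [y']; then [face1_face1] applies. *)
Lemma face1_face1_agree w s (t : B w s) u v (x : B u col_c) (y : B v s)
    u' v' (x' : B u' col_c) (y' : B v' s) :
  size w = n.+1 -> heq t (face1 x y) -> heq t (face1 x' y') -> (size u <= size u')%N ->
  heq (face1 (h x) (h y)) (face1 (h x') (h y')).
Proof.
move=> sw txy txy' uu'; have [e1 _] := txy'.
have sn : size (flatten [:: u'; v']) = n.+1 by rewrite -sw e1.
have xx' := heq_trans (heq_sym txy) txy'; have := heq_coords xx'.
rewrite !coords_face1 => ecs.
have [e _] := xx'; rewrite /= !cats0 in e.
have u0 := box_size_gt0 x; have v0 := box_size_gt0 y'.
have sx := size_coords x; have sx' := size_coords x'.
have [m [eu' ev]] := cat_compare e uu'; subst u' v.
have cxx' : (size (coords x) <= size (coords x'))%N by rewrite sx sx'; lia.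
have [k [ek ek2]] := cat_compare ecs cxx'.
have sk : size k = size m by move: sx'; rewrite ek !size_cat sx; lia.
case: m x' y sk sx' uu' txy txy' xx' ecs ek ek2 cxx' e1 sn e => [|d m]
    x' y sk sx' uu' txy txy' xx' ecs ek ek2 cxx' e1 sn e.
  move/size0nil: sk => k0; subst k; case: ek2 => ey.
  apply: face1_heq; apply: box_family_heq; apply: box_heq; rewrite ?cats0 //.
  by rewrite ek cats0.
case: k sk ek ek2 => [//|k0 k] /= [sk] ek [ek0 ey]; subst k0.
have pz : profile (d :: m) col_c.
  by have := restrictP x'; rewrite profile_catE ?(box_neq_nil x) // => /andP[].
pose z : B (d :: m) col_c := box_of pz k.
have cz : coords z = k by rewrite coords_box_of.
have xz : heq x' (face1 x z).
  by apply: box_heq; [rewrite /= cats0|rewrite coords_face1 cz ek].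
have yz : heq y (face1 z y').
  by apply: box_heq; [rewrite /= cats0|rewrite coords_face1 cz ey].
have sw' : (size u + size (d :: m) + size v' = n.+1)%N.
  by move: sn; rewrite !size_cat /= ?size_cat /=; lia.
apply: heq_sym; apply: (face1_face1 (M := E) (x := h x) (y := h z) (z := h y') (xy := h x') (yz := h y)).
- rewrite -(pl_face1 hn); first exact: box_family_heq.
  by rewrite size_cat; lia.
- rewrite -(pl_face1 hn); first exact: box_family_heq.
  by rewrite size_cat; lia.
Qed.

Section Word.
Variables (w : seq colour) (s : colour).
Hypothesis sw : size w = n.+1.

(** A relation rather than a function, because [t] may lie on several faces; each of them prescribes
    a value. *)
Inductive boundary_value (t : B w s) (e : E w s) : Prop :=
| BoundaryValue0 l a r (x : B (l ++ a :: r) s) of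
    heq t (face0 x) & heq e (face0 (h x))
| BoundaryValue1 u v (x : B u col_c) (y : B v s) of
    heq t (face1 x y) & heq e (face1 (h x) (h y)).

Lemma boundary_value_uniq t e e' :
  boundary_value t e -> boundary_value t e' -> e = e'.
Proof.
case=> [l a r x tx ex|u v x y tx ex]; case=> [l' a' r' x' tx' ex'|u' v' x' y' tx' ex'];
  apply: heq_eq; apply: heq_trans ex _; apply: heq_trans (heq_sym ex').
- have [ll'|l'l] := leqP (size l) (size l').
    exact: (face0_face0_agree sw tx tx').
  by apply: heq_sym; exact: (face0_face0_agree sw tx' tx (ltnW l'l)).
- exact: (face0_face1_agree sw tx tx').
- by apply: heq_sym; exact: (face0_face1_agree sw tx' tx).
- have [uu'|u'u] := leqP (size u) (size u').
    exact: (face1_face1_agree sw tx tx').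
  by apply: heq_sym; exact: (face1_face1_agree sw tx' tx (ltnW u'u)).
Qed.

Lemma boundary_value_boundary t e : boundary_value t e -> box_boundary t.
Proof.
case=> [l a r x tx _|u v x y tx _]; rewrite /box_boundary /= (heq_coords tx).
  by left; rewrite coords_face0 /insert0 !mem_cat mem_head orbT.
by right; rewrite coords_face1 mem_cat mem_head orbT.
Qed.

Lemma boundary_value_lift t e : boundary_value t e -> p w s e = g w s t.
Proof.
have pE w' w'' s' (x : E w' s') (y : E w'' s') : heq x y -> heq (p _ _ x) (p _ _ y).
  by move/(heq_map p).
have gE w' w'' s' (x : B w' s') (y : B w'' s') : heq x y -> heq (g _ _ x) (g _ _ y).
  by move/(heq_map g).
case=> [l a r x tx ex|u v x y tx ex]; have [e1 _] := tx;
  apply: heq_eq; apply: heq_trans (pE _ _ _ _ _ ex) _;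
  apply: heq_trans (heq_sym (gE _ _ _ _ _ tx)); apply: eq_heq.
  rewrite /face0 !bmap_ract (pl_lift hn) //.
  by rewrite -ltnS -sw e1 !size_cat /= !addnS.
have u0 := box_size_gt0 x; have v0 := box_size_gt0 y.
have : (size u + size v = n.+1)%N by rewrite -sw e1 /= !size_cat /= addn0.
by rewrite /face1 !bmap_lact /= => suv; rewrite !(pl_lift hn) //; lia.
Qed.

(** Deleting the coordinate [i] makes sense on the whole box, so the prescription on this face is
    the restriction of a globally continuous map. *)
Lemma boundary_value_face0 i : (i < n)%N -> profile w s ->
  exists F : B w s -> E w s, continuous F /\
    forall t, box_face i (I0 R) t -> boundary_value t (F t).
Proof.
move=> ilt pw; have iw : (i.+1 < size w)%N by rewrite sw ltnS.
(* Counted from 0, coordinate [i] separates the letters [i] and [i.+1]; on this face they come from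
   a single input of colour [a]. *)
have : drop i w = nth col_c w i :: nth col_c w i.+1 :: drop i.+2 w.
  by rewrite (drop_nth col_c (ltnW iw)) (drop_nth col_c iw).
move: (nth col_c w i) (nth col_c w i.+1) (drop i.+2 w) => b a r Ed.
have Ew : w = take i w ++ [:: b; a] ++ r by rewrite /= -Ed cat_take_drop.
have sl : size (take i w) = i by rewrite size_takel // ltnW // ltnW.
move: (take i w) sl Ew => l sl Ew.
have Eb : b = col_c.
  by move: pw; rewrite Ew profile_cat // profile_cons2 => /and3P[_ /eqP].
subst b; have Ew' := esym Ew.
have pl : profile (l ++ a :: r) s by rewrite -profile_insert Ew'.
have sn : (size l + size r).+1 = n by move: sw; rewrite Ew !size_cat /= !addnS => -[].
have sc (t : B w s) : size (coords t) = n by rewrite size_coords sw.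
pose del (t : B w s) : B (l ++ a :: r) s := box_of pl (take i (coords t) ++ drop i.+1 (coords t)).
have cdel t : coords (del t) = take i (coords t) ++ drop i.+1 (coords t).
  by rewrite coords_box_of // size_cat size_drop size_takel sc ?(ltnW ilt) // size_cat /= addnS /=; lia.
have del_continuous : continuous del.
  apply: (to_box_continuous cdel); apply: seq_continuous_cat.
    exact: seq_continuous_take (@coords_continuous R _ _).
  exact: seq_continuous_drop (@coords_continuous R _ _).
exists (fun t => cast Ew' (face0 (h (del t)))); split.
  apply: continuous_compose (@cast_continuous _ _ _ _ _ _).
  apply: (@space_kcontinuous (B w s) _ _
    (fun t => (h (del t), star2 a)) _ _ (@ract_continuous _ _ _ E l a r [:: col_c; a] s)).
  apply: continuous_pair; last exact: cst_continuous.
  apply: (continuous_compose del_continuous); apply: (pl_continuous hn).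
  by rewrite -sn size_cat /= addnS.
move=> t [_ ti]; apply: (BoundaryValue0 (x := del t)); last exact: heq_cast.
apply: box_heq => //; rewrite coords_face0 cdel.
have st : size (take i (coords t)) = size l by rewrite size_takel ?sl // sc ltnW.
rewrite -st insert01_cat -{1}(cat_take_drop i (coords t)); congr (_ ++ _).
by rewrite (drop_nth (I0 R)) ?ti // sc.
Qed.

Lemma boundary_value_face1 i : (i < n)%N -> profile w s ->
  exists F : B w s -> E w s, continuous F /\
    forall t, box_face i (I1 R) t -> boundary_value t (F t).
Proof.
move=> ilt pw; have iw : (i.+1 < size w)%N by rewrite sw ltnS.
(* A piece with [i] coordinates has [i.+1] inputs, so the cut at coordinate [i] comes after [i.+1]
   letters. *)
have := cat_take_drop i.+1 w.
have su : size (take i.+1 w) = i.+1 by rewrite size_takel // ltnW.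
have sv : size (drop i.+1 w) = (n - i)%N by rewrite size_drop sw subSS.
move: (take i.+1 w) (drop i.+1 w) su sv => u v su sv Ew.
have u0 : u != [::] by rewrite -size_eq0 su.
have v0 : v != [::] by rewrite -size_eq0 sv subn_eq0 -ltnNge.
have Ew' : flatten [:: u; v] = w by rewrite /= cats0.
have /andP[pu pv] : profile u col_c && profile v s by rewrite -profile_catE // Ew.
have sc (t : B w s) : size (coords t) = n by rewrite size_coords sw.
pose left_ (t : B w s) : B u col_c := box_of pu (take i (coords t)).
pose right_ (t : B w s) : B v s := box_of pv (drop i.+1 (coords t)).
have cl t : coords (left_ t) = take i (coords t).
  by rewrite coords_box_of // size_takel ?su // sc ltnW.
have cr t : coords (right_ t) = drop i.+1 (coords t).
  by rewrite coords_box_of // size_drop sc sv subnS.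
have lc : continuous left_.
  by apply: (to_box_continuous cl); exact: seq_continuous_take (@coords_continuous R _ _).
have rc : continuous right_.
  by apply: (to_box_continuous cr); exact: seq_continuous_drop (@coords_continuous R _ _).
exists (fun t => cast Ew' (face1 (h (left_ t)) (h (right_ t)))); split.
  apply: continuous_compose (@cast_continuous _ _ _ _ _ _).
  apply: (@space_kcontinuous (B w s) _ _
    (fun t => (star2 s, (h (left_ t), (h (right_ t), tt : discrete_space unit)))) _ _
    (@lact_continuous _ _ _ E [:: col_c; s] s [:: u; v])).
  apply: continuous_pair; first exact: cst_continuous.
  apply: continuous_pair.
    by apply: (continuous_compose lc); apply: (pl_continuous hn); rewrite su.
  apply: continuous_pair; last exact: cst_continuous.
  by apply: (continuous_compose rc); apply: (pl_continuous hn); rewrite sv leq_subr.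
move=> t [_ ti]; apply: (BoundaryValue1 (x := left_ t) (y := right_ t)); last exact: heq_cast.
apply: box_heq => //; rewrite coords_face1 cl cr.
rewrite -{1}(cat_take_drop i (coords t)); congr (_ ++ _).
by rewrite (drop_nth (I0 R)) ?ti // sc.
Qed.

Lemma boundary_lift : exists hw : B w s -> E w s,
  [/\ continuous hw, forall t, p w s (hw t) = g w s t &
      forall t e, boundary_value t e -> hw t = e].
Proof.
have [pw|npw] := boolP (profile w s); last first.
  have nt (t : B w s) : False by move: (restrictP t); rewrite (negbTE npw).
  by exists (@h w s); split=> t; case: (nt t).
(* Off the boundary the value is arbitrary, since [lifts_from] sees only the restriction. On each
   face [phi] coincides with a continuous map, which suffices because the faces form a finite closed
   cover. *)
pose phi (t : B w s) : E w s :=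
  if pselect (exists e, boundary_value t e) is left ex then projT1 (cid ex) else @h w s t.
have phiE t e : boundary_value t e -> phi t = e.
  rewrite /phi => te; case: pselect => [ex|[]]; last by exists e.
  exact: boundary_value_uniq (projT2 (cid ex)) te.
have sw1 : (size w).-1 = n by rewrite sw.
have phi_face i e : (e = I0 R \/ e = I1 R) -> (i < n)%N ->
    exists F : B w s -> E w s, continuous F /\
      forall t, box_face i e t -> boundary_value t (F t).
  by case=> -> ilt; [exact: boundary_value_face0|exact: boundary_value_face1].
have [||t tb|hw [chw hwphi phw]] := box_trivial_lift (w := w) (s := s)
    (pF w s) (pW w s) (a := phi) (b := g w s).
- rewrite box_boundaryE; apply: within_bigsetU => [i|i].
    by apply: closedU; exact: closed_box_face.
  rewrite mem_iota add0n sw1 => /andP[_ ilt].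
  apply: withinU_continuous; try exact: closed_box_face.
    have [F [cF Ft]] := phi_face i _ (or_introl erefl) ilt.
    apply: (within_eq (f := F)); last exact: continuous_subspaceT.
    by move=> t /Ft /phiE.
  have [F [cF Ft]] := phi_face i _ (or_intror erefl) ilt.
  apply: (within_eq (f := F)); last exact: continuous_subspaceT.
  by move=> t /Ft /phiE.
- exact: (@bmap_continuous _ _ _ _ g).
- have [e te] : exists e, boundary_value t e.
    move: tb; rewrite box_boundaryE -bigcup_seq => -[i]; rewrite /= mem_iota add0n sw1 => /andP[_ ilt] [] ti.
      have [F [_ Ft]] := phi_face i _ (or_introl erefl) ilt.
      by exists (F t); exact: Ft.
    have [F [_ Ft]] := phi_face i _ (or_intror erefl) ilt.
    by exists (F t); exact: Ft.
  by rewrite (phiE _ _ te); exact: boundary_value_lift te.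
exists hw; split=> // t e te.
by rewrite hwphi ?(phiE _ _ te) //; exact: boundary_value_boundary te.
Qed.

End Word.

Lemma partial_lift_step : exists h',
  (forall w s, (size w <= n)%N -> h' w s = @h w s) /\ partial_lift n.+1 h'.
Proof.
have ext w s : exists hw : B w s -> E w s, size w = n.+1 ->
    [/\ continuous hw, forall t, p w s (hw t) = g w s t &
      forall t e, boundary_value t e -> hw t = e].
  have [sw|sw] := eqVneq (size w) n.+1; last by exists (@h w s) => /eqP; rewrite (negbTE sw).
  by have [hw] := boundary_lift s sw; exists hw.
pose h' w s : B w s -> E w s := if size w == n.+1 then projT1 (cid (ext w s)) else @h w s.
have h'h w s : (size w <= n)%N -> h' w s = @h w s.
  by move=> wn; rewrite /h' ltn_eqF.
have h'P w s : size w = n.+1 -> [/\ continuous (h' w s), forall t, p w s (h' w s t) = g w s t &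
      forall t e, boundary_value t e -> h' w s t = e].
  by move=> sw; rewrite /h' (introT eqP sw); exact: (projT2 (cid (ext w s)) sw).
exists h'; split=> //; split.
- move=> w s; rewrite leq_eqVlt ltnS => /orP[/eqP sw|wn]; first by have [] := h'P w s sw.
  by rewrite h'h //; exact: (pl_continuous hn).
- move=> w s x; rewrite leq_eqVlt ltnS => /orP[/eqP sw|wn]; first by have [] := h'P w s sw.
  by rewrite h'h // (pl_lift hn).
- move=> l a r s x; rewrite ltnS => xn; rewrite [in RHS]h'h //.
  have sE : size (l ++ [:: col_c; a] ++ r) = (size (l ++ a :: r)).+1.
    by rewrite !size_cat /= !addnS.
  have [sw|sw] := eqVneq (size (l ++ [:: col_c; a] ++ r)) n.+1.
    have [_ _ h'b] := h'P _ s sw.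
    by apply: h'b; apply: (BoundaryValue0 (x := x)); exact: heq_refl.
  have xn' : (size (l ++ a :: r) < n)%N by move: sw; rewrite sE eqSS ltn_neqAle xn andbT.
  by rewrite h'h ?sE // (pl_face0 hn).
- move=> u v s x y uvn.
  have u0 := box_size_gt0 x; have v0 := box_size_gt0 y.
  have sE : size (flatten [:: u; v]) = (size u + size v)%N by rewrite /= cats0 size_cat.
  have un : (size u <= n)%N by move: uvn; rewrite size_cat; lia.
  have vn : (size v <= n)%N by move: uvn; rewrite size_cat; lia.
  rewrite [in RHS]h'h // [in RHS]h'h //.
  have [sw|sw] := eqVneq (size (flatten [:: u; v])) n.+1.
    have [_ _ h'b] := h'P _ s sw.
    by apply: h'b; apply: (BoundaryValue1 (x := x) (y := y)); exact: heq_refl.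
  have uvn' : (size (u ++ v) <= n)%N.
    by move: uvn; rewrite leq_eqVlt ltnS size_cat -sE (negbTE sw).
  by rewrite h'h ?sE -?size_cat // (pl_face1 hn).
Qed.

End Step.

Lemma partial_lift0 h : partial_lift 0 h.
Proof.
have ne w s (t : B w s) : (size w <= 0)%N -> False.
  by move=> w0; have := box_size_gt0 t; rewrite ltnNge w0.
split.
- by move=> w s w0 t; case: (ne w s t w0).
- by move=> w s t w0; case: (ne w s t w0).
- by [].
- move=> u v s x y; rewrite size_cat leqn0 addn_eq0 => /andP[/eqP u0 _].
  by case: (ne u col_c x); rewrite u0.
Qed.

(** The induction needs values on words not yet treated; they exist because [p] is surjective on
    path components. *)
Lemma box_family_inhabited : exists h : box_family, True.
Proof.
have ex w s (t : B w s) : exists e : E w s, True.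
  by have [_ [_ /(_ (g w s t))[e _]] _] := pW w s; exists e.
by exists (fun w s t => projT1 (cid (ex w s t))).
Qed.

Lemma box_lift : exists h : bimod_map B E, forall w s x, p w s (h w s x) = g w s x.
Proof.
have [h0 _] := box_family_inhabited.
have /choice[st stP] : forall nh : nat * box_family, exists h', partial_lift nh.1 nh.2 ->
    (forall w s, (size w <= nh.1)%N -> h' w s = nh.2 w s) /\ partial_lift nh.1.+1 h'.
  move=> [n h] /=; have [hn|hn] := pselect (partial_lift n h).
    by have [h' h'P] := partial_lift_step hn; exists h'.
  by exists h.
pose H := fix H n := if n is m.+1 then st (m, H m) else h0.
have HP n : partial_lift n (H n).
  by elim: n => [|n IH]; [exact: partial_lift0|exact: (stP (n, H n) IH).2].
have Hs n w s : (size w <= n)%N -> H n w s = H (size w) w s.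
  elim: n => [|n IH]; first by rewrite leqn0 => /eqP ->.
  rewrite leq_eqVlt ltnS => /orP[/eqP <- //|wn].
  by rewrite -IH //; exact: (stP (n, H n) (HP n)).1.
(* Stages agree on words already treated, and the arguments of an operation have words no longer
   than its result, so compatibility can be read off at the stage of the result. *)
pose h w s : B w s -> E w s := H (size w) w s.
have hr l a r s (x : B (l ++ a :: r) s) : h _ _ (ract B x (star2 a)) = ract E (h _ _ x) (star2 a).
  have sE : size (l ++ [:: col_c; a] ++ r) = (size (l ++ a :: r)).+1.
    by rewrite !size_cat /= !addnS.
  rewrite {1}/h -/(face0 x) (pl_face0 (HP _)) ?sE //.
  by rewrite Hs.
have hl u v s (x : B u col_c) (y : B v s) :
    h _ _ (lact B (P := [:: u; v]) (star2 s) (x, (y, tt)))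
    = lact E (P := [:: u; v]) (star2 s) (h _ _ x, (h _ _ y, tt)).
  have sE : size (flatten [:: u; v]) = (size u + size v)%N by rewrite /= cats0 size_cat.
  rewrite {1}/h -/(face1 x y) (pl_face1 (HP _)) ?sE ?size_cat //.
  by rewrite !Hs ?leq_addr ?leq_addl.
unshelve eexists.
  apply: (@BimodMap _ _ B E h).
  - by move=> w s; exact: (pl_continuous (HP _)).
  - by move=> l a r u s x y; exact: (generators_ract hr).
  - by move=> w s P x y; exact: (generators_lact hl).
by move=> w s x; exact: (pl_lift (HP _)).
Qed.

End Lifting.

(** * The cofibrant replacement *)

Section Initial.

Definition void_seq : colseq colour := fun _ _ => void_space.

(** The absence of nullary operations makes the empty sequence a bimodule: a left operation always
    has an argument, and here none exists. *)
Lemma void_hprod w s P : Act w s -> hprod void_seq P w -> False.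
Proof.
by case: w P => [|a w] [|p P] x; [have := restrictP x; rewrite profile_nil|case|case|case=> -[]].
Qed.

Definition void_lact w s P (x : Act w s) (y : hprod void_seq P w) : void_seq (flatten P) s :=
  match void_hprod x y with end.

Definition void_struct : bimod_struct Act void_seq.
Proof.
apply: (@BimodStruct _ Act void_seq (fun _ _ _ _ _ x _ => x) void_lact).
- by move=> l a r u s [[]].
- by move=> w s P [x y]; case: (void_hprod x y).
- by move=> ? ? ? ? ? ? ? ? [].
- by move=> ? ? ? ? ? ? ? ? [].
- by move=> ? ? ? ? [].
- by move=> ? ? [].
- by move=> ? ? ? ? ? ? ? ? x x' y1 y2 y3; case: (void_hprod x' y2).
- by move=> ? ? ? ? ? ? ? ? ? ? ? ? [].
Defined.

Lemma void_initial : bimod_initial (Bimodule void_struct).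
Proof.
move=> M; unshelve eexists.
  apply: (@BimodMap _ _ (Bimodule void_struct) M (fun w s x => match (x : void) with end)).
  - by move=> w s [].
  - by move=> ? ? ? ? ? [].
  - by move=> w s P x y; case: (void_hprod x y).
by move=> f w s [].
Qed.

End Initial.

Section WeakEquivalence.
Variable R : realType.
Local Notation I := (I01 R).
Local Notation ival := (set_val : I -> R).

Definition segment n (x y : cube R n) (u : I) : cube R n := fun i =>
  clamp (ival (x i) + ival u * (ival (y i) - ival (x i)))%R.

Lemma segment0 n (x y : cube R n) : segment x y (I0 R) = x.
Proof. by apply: cube_eq => i; rewrite /segment ival0 mul0r addr0 ivalK. Qed.

Lemma segment1 n (x y : cube R n) : segment x y (I1 R) = y.
Proof. by apply: cube_eq => i; rewrite /segment ival1 mul1r addrC subrK ivalK. Qed.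

Lemma segment_id n (x : cube R n) u : segment x x u = x.
Proof. by apply: cube_eq => i; rewrite /segment subrr mulr0 addr0 ivalK. Qed.

Lemma segment_continuous (T : topologicalType) n (f g : T -> cube R n) (u : T -> I) :
  continuous f -> continuous g -> continuous u ->
  continuous (fun z => segment (f z) (g z) (u z)).
Proof.
move=> cf cg cu; apply: to_cube_continuous => i; apply: clamp_continuous.
have cv (k : T -> cube R n) : continuous k -> continuous (fun z => ival (k z i)).
  move=> ck; apply: (@continuous_compose T I R (fun z => k z i) ival).
    exact: (continuous_compose ck (@cube_coord_continuous R n i)).
  exact: ival_continuous.
apply: continuous_addR; first exact: cv.
apply: continuous_mulR; first exact: (continuous_compose cu (@ival_continuous R)).
by apply: continuous_subR; exact: cv.
Qed.

(** By convexity, straight segments join any two points and any two spheroids; they fix the boundary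
    because the segment from a point to itself is constant. If [b] is false, both sides are
    empty. *)
Lemma restrict_weak_equivalence b n (f : Defs.restrict b (cube_space R n) -> Defs.restrict b point_space) :
  weak_homotopy_equivalence R f.
Proof.
case: b f => f; last first.
  by split; [case|split; [case|case]|move=> ? []].
have fE (t t' : cube R n) : f t = f t' by case: (f t) (f t') => -[].
split.
- have -> : f = fun=> f (corner R n) by apply: funext => t; exact: fE.
  exact: cst_continuous.
- split=> [x x' _|y]; last first.
    exists (corner R n); exists (fun=> y); split=> //; first exact: cst_continuous.
    by case: y (f _) => -[].
  exists (segment (x : cube R n) x'); split; rewrite ?segment0 ?segment1 //.
  by apply: segment_continuous; [exact: cst_continuous|exact: cst_continuous|exact: continuous_id].
move=> m x _; split=> [k k' [ck kx] [ck' k'x] _|k [ck kx]].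
  exists (fun z => segment (k z.1 : cube R n) (k' z.1) z.2); split.
  - apply: segment_continuous; last exact: continuous_snd.
      exact: (continuous_compose (@continuous_fst _ _) ck).
    exact: (continuous_compose (@continuous_fst _ _) ck').
  - by move=> t; rewrite segment0.
  - by move=> t; rewrite segment1.
  - by move=> t u bt; rewrite /= kx // k'x // segment_id.
exists (fun=> x); first by split=> //; exact: cst_continuous.
exists (fun=> f x); split=> //; first exact: cst_continuous.
by move=> t; case: (f x) (k t) => -[].
Qed.

Lemma box_to_act_continuous w s : continuous (@box_to_act R w s).
Proof.
move=> x U /nbhs_singleton Ux; apply: (@filterS (box R w s) (nbhs x) _ setT); last exact: filterT.
by move=> y _; rewrite /= (act_elt_uniq (box_to_act y) (box_to_act x)).
Qed.

Definition box_augmentation : bimod_map (Bimodule (box_struct R)) Act_bimodule.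
Proof.
apply: (@BimodMap _ _ (Bimodule (box_struct R)) Act_bimodule (@box_to_act R)).
- exact: box_to_act_continuous.
- by move=> *; exact: act_elt_uniq.
- by move=> *; exact: act_elt_uniq.
Defined.

End WeakEquivalence.

Theorem proposition3p14 (R : realType) :
  exists B : bimod_struct Act (box R),
    unique (@box_operations R) B /\
    cofibrant_replacement R (Bimodule B) Act_bimodule.
Proof.
exists (box_struct R); split; first exact: box_struct_unique.
split.
  have [i _] := void_initial (Bimodule (box_struct R)).
  exists (Bimodule void_struct), i; split; first exact: void_initial.
  move=> E X p f g pF pW _; have [h ph] := box_lift g pF pW.
  by exists h; split=> // w s [].
by exists (box_augmentation R) => w s; exact: restrict_weak_equivalence.
Qed.
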